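(* $B^{m}\restriction H^{Im}=G^{m}B(G^{m})^{-1}$.
   Context: Inner products are linear in the second argument. $B$ is a bounded self-adjoint operator on a (nonzero) separable complex Hilbert space $H$ with $\|B\|<1$ and $B(v)\neq0$ for all $v\ne0$. Let $A=e^{iB}$, a unitary operator, and assume $H$ has a vector $\phi$ of norm $1$ that is cyclic with respect to $A$: $\{P(A,A^* )(\phi)\mid P\in\mathbb C[X,Y]\}$ is dense in $H$, where $P(A,A^{*})$ is obtained by substituting $A$ for $X$ and $A^{*}$ for $Y$. For $N\in\omega$: $H_N$ is the span of $\{A^{i}(A^{*})^{j}\phi\mid i\le N,\ j\le N\}$, $H_N^{-}$ the span of those with $i<N,\ j\le N$, $H_N^{+}$ the span of those with $0<i\le N,\ j\le N$; $W^{\pm}$ are the orthogonal complements of $H_N^{\pm}$ in $H_N$ (of equal dimension). Fix a unitary $U_N:W^{-}\to W^{+}$ and let $A_N$ be the linear operator on $H_N$ with $A_N(u)=A(u)$ for $u\in H_N^{-}$ and $A_N(u)=U_N(u)$ for $u\in W^{-}$; $A_N$ is unitary. $D_N=\dim H_N$ and $u_N(n)$, $n<D_N$, is an orthonormal basis of $H_N$ of eigenvectors of $A_N$ with eigenvalues $\lambda_N(n)$, chosen so that $\xi_N(n)=\langle u_N(n)|\phi\rangle$ is a non-negative real. $B_N$ is the self-adjoint operator on $H_N$ with $B_N(u_N(n))=q\,u_N(n)$, where $q\in(-\pi,\pi]$ and $\lambda_N(n)=e^{iq}$. $\mathcal{U}$ is an ultrafilter on $\omega$ such that for all $m\ge1$,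 $\{N\ge1\mid\sqrt N\in\omega,\ m\text{ divides }\sqrt N\}\in\mathcal{U}$. $H^{u}=\prod_NH_N/\mathcal{U}$; $\|\cdot\|_2^u$, $\langle\cdot|\cdot\rangle^u$ are the ultraproducts of the norms and inner products; $u\sim v$ iff $\|u-v\|_2^u$ is infinitesimal; $H^m$ is the Hilbert space of classes $v/\sim$ with $\|v\|_2^u$ bounded by a natural number, where $\langle u|v\rangle$ is the complex number infinitely close to $\langle u|v\rangle^u$. $B^m$ is the operator on $H^m$ induced by the uniformly bounded operators $(B_N)_N$. $G^m:H\to H^m$ is the isometric embedding given by $G^m(P(A,A^* )\phi)=(P(A,A^* )\phi)_{N<\omega}/\mathcal{U}/\sim$ and continuity, and $H^{Im}$ is its range. Standing technical assumption: let $M>1$ be a natural number, $S=\{\lambda\in\mathbb C\mid|\mathrm{Re}\,\lambda|\le M,|\mathrm{Im}\,\lambda|\le M\}$, $\mu_N(X)=\sum\{\xi_N(n)^2\mid n<D_N,\lambda_N(n)\in X\}$ and $\mu^{\mathrm n}(X)=\lim_{\mathcal U}\mu_N(X)$ for $X\subseteq\mathbb C$. A real $r\in[-M,M]$ is nice if for all $\delta>0$ there is $\varepsilon>0$ such that $\mu^{\mathrm n}(\{\lambda\in S\mid|\mathrm{Re}\,\lambda-r|<\varepsilon\})<\delta$ and $\mu^{\mathrm n}(\{\lambda\in S\mid|\mathrm{Im}\,\lambda-r|<\varepsilon\})<\delta$. $NI$ is a fixed countable dense subset of $[-M,M]$ consisting of nice reals and containing $-M,M$; it is assumed that $\mathrm{Re}(e^{i})\in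 NI$ (in particular $\mathrm{Re}(e^i)$ is nice). *)

(* Defs.v *)
From HB Require Import structures.
From mathcomp Require Import all_boot all_order all_algebra.
From mathcomp Require Import ring_quotient sesquilinear.
From mathcomp Require Import all_classical all_reals all_analysis.
From mathcomp Require Import complex.
Set Implicit Arguments.
Unset Strict Implicit.
Unset Printing Implicit Defensive.
Import Order.TTheory GRing.Theory Num.Theory.
Import numFieldNormedType.Exports.
Local Open Scope classical_set_scope.
Local Open Scope ring_scope.
Local Open Scope quotient_scope.

(* [{dot V for Num.conj}] is the library's type of positive definite
   sesquilinear forms; these are linear in the first argument.  [inner] below
   swaps the arguments, so that it is linear in the second one. *)
HB.mixin Record isInnerProduct (C : numClosedFieldType) V
    of NormedModule C V := {
  dotp : {dot V for Num.conj};
  normr_dotp : forall v : V, `|v| ^+ 2 = dotp v v }.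

#[short(type="innerProductType")]
HB.structure Definition InnerProduct (C : numClosedFieldType) :=
  {V of NormedModule C V & isInnerProduct C V}.

#[short(type="hilbertType")]
HB.structure Definition Hilbert (C : numClosedFieldType) :=
  {V of CompleteNormedModule C V & InnerProduct C V}.

Definition inner (C : numClosedFieldType) (V : innerProductType C) (u v : V) :
  C :=
  dotp v u.

Section DotNorm.
Variables (C : numClosedFieldType) (V : lmodType C) (f : {dot V for Num.conj}).

Definition dnorm (v : V) : C := sqrtC (f v v).

Let f_ge0 v : 0 <= f v v. Proof. exact: dnorm_ge0. Qed.

Lemma dnormK v : dnorm v ^+ 2 = f v v. Proof. by rewrite sqrtCK. Qed.

Let dnorm_pos v : 0 <= dnorm v. Proof. by rewrite sqrtC_ge0. Qed.

Let fC u v : f u v = (f v u)^*.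
Proof. by rewrite hermC expr0 mul1r. Qed.

Lemma dnorm_eq0_eq0 v : dnorm v = 0 -> v = 0.
Proof. by move=> /eqP; rewrite sqrtC_eq0 dnorm_eq0 => /eqP. Qed.

Lemma dnorm_scale (a : C) v : dnorm (a *: v) = `|a| * dnorm v.
Proof. by rewrite /dnorm dnormZ sqrtCM ?qualifE/= ?exprn_ge0// sqrCK. Qed.

Lemma dot_CauchySchwarz u v : `|f u v| <= dnorm u * dnorm v.
Proof.
have [->|v0] := eqVneq v 0.
  by rewrite linear0r normr0 mulr_ge0.
have fv0 : 0 < f v v by exact: neq0_dnorm_gt0.
have fvR : (f v v)^* = f v v by rewrite -fC.
pose a := f u v / f v v.
have fua : f u (a *: v) = `|f u v| ^+ 2 / f v v.
  by rewrite linearZ/= /a rmorphM/= fmorphV/= fvR normCKC mulrAC.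
have faa : f (a *: v) (a *: v) = `|f u v| ^+ 2 / f v v.
  rewrite dnormZ /a normrM normfV (gtr0_norm fv0) exprMn exprVn.
  rewrite -mulrA; congr (_ * _); rewrite expr2 invfM -mulrA.
  by rewrite mulVf ?mulr1 ?gt_eqF.
have := f_ge0 (u - a *: v).
rewrite dnormB faa fua.
have -> : (`|f u v| ^+ 2 / f v v)^* = `|f u v| ^+ 2 / f v v.
  rewrite rmorphM fmorphV rmorphXn/= fvR; congr (_ ^+ 2 / _).
  by rewrite conj_Creal ?normr_real.
rewrite opprD addrA addrK subr_ge0 ler_pdivrMr// => h.
by rewrite -(@ler_pXn2r _ 2)// ?nnegrE ?mulr_ge0// exprMn !dnormK.
Qed.

Lemma dnorm_triangle u v : dnorm (u + v) <= dnorm u + dnorm v.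
Proof.
rewrite -(@ler_pXn2r _ 2)// ?nnegrE ?addr_ge0// dnormK dnormD sqrrD !dnormK.
rewrite [leRHS]addrAC lerD2l.
have -> : f u v + (f u v)^* = 2 * 'Re (f u v) by rewrite ReE mulrC divfK.
rewrite -[leRHS]mulr_natl ler_pM2l ?ltr0n//.
apply: le_trans (dot_CauchySchwarz u v).
apply: le_trans (real_ler_norm _) (leif_normC_Re_Creal _).1; exact: Creal_Re.
Qed.

End DotNorm.

HB.factory Record Lmodule_isInnerProduct (C : numClosedFieldType) V
    of GRing.Lmodule C V := { dform : {dot V for Num.conj} }.

HB.builders Context C V of Lmodule_isInnerProduct C V.

HB.instance Definition _ := Lmodule_isNormed.Build C V
  (dnorm_triangle dform) (dnorm_scale dform) (@dnorm_eq0_eq0 _ _ dform).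
HB.instance Definition _ := isInnerProduct.Build C V (dnormK dform).

HB.end.

Section Span.
Variables (K : nzRingType) (V : lmodType K).

Definition linspan (X : set V) : {pred V} := fun v =>
  `[< exists n (c : 'I_n -> K) (x : 'I_n -> V),
        (forall i, X (x i)) /\ v = \sum_i c i *: x i >].

Lemma linspan_submod_closed X : submod_closed (linspan X).
Proof.
split=> [|a u v /asboolP[m [c [x [Xx ->]]]] /asboolP[n [d [y [Yy ->]]]]].
  apply/asboolP; exists 0%N, (fun=> 0), (fun=> 0).
  by split=> [[]//|]; rewrite big_ord0.
apply/asboolP; exists (m + n)%N.
exists (fun i => match fintype.split i with inl j => a * c j | inr j => d j end).
exists (fun i => match fintype.split i with inl j => x j | inr j => y j end).
split=> [i|]; first by case: splitP.
rewrite big_split_ord/= scaler_sumr; congr (_ + _).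
  by apply: eq_bigr => i _; rewrite (unsplitK (inl i)) scalerA.
by apply: eq_bigr => i _; rewrite (unsplitK (inr i)).
Qed.

HB.instance Definition _ X :=
  GRing.isSubmodClosed.Build K V (linspan X)
    (GRing.submod_closed_semi (linspan_submod_closed X)).

End Span.

Definition orthocomp (C : numClosedFieldType) (V : innerProductType C)
    (S T : {pred V}) : {pred V} :=
  fun v => (v \in S) && `[< forall w, w \in T -> inner w v = 0 >].

Section OrthoComp.
Variables (C : numClosedFieldType) (V : innerProductType C).
Variables (S : submodClosed V) (T : {pred V}).

Lemma orthocomp_submod_closed : submod_closed (orthocomp S T).
Proof.
split=> [|a u v /andP[Su /asboolP ou] /andP[Sv /asboolP ov]].
  apply/andP; split; first exact: rpred0.
  by apply/asboolP => w _; rewrite /inner linear0l.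
apply/andP; split; first by rewrite rpredD// rpredZ.
apply/asboolP => w Tw; rewrite /inner linearPl/=.
by have := ou _ Tw; have := ov _ Tw; rewrite /inner => -> ->; rewrite mulr0 addr0.
Qed.

HB.instance Definition _ :=
  GRing.isSubmodClosed.Build C V (orthocomp S T)
  (GRing.submod_closed_semi orthocomp_submod_closed).

End OrthoComp.

Section Subspace.
Variables (K : nzRingType) (V : lmodType K) (S : submodClosed V).

Record subsp := Subsp { subsp_val : V; _ : subsp_val \in S }.

HB.instance Definition _ := [isSub for subsp_val].
HB.instance Definition _ := [Choice of subsp by <:].
HB.instance Definition _ := [SubChoice_isSubLmodule of subsp by <:].

End Subspace.

Section SubspaceInner.
Variables (C : numClosedFieldType) (V : innerProductType C) (S : submodClosed V).

Definition subsp_dot (u v : subsp S) : C := dotp (val u) (val v).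

Lemma subsp_dot_is_bilinear :
  bilinear_for (GRing.Scale.Law.clone _ _ *%R _)
    (GRing.Scale.Law.clone _ _ (Num.conj \; *%R) _) subsp_dot.
Proof.
by split=> [v|u] a x y; rewrite /subsp_dot linearP ?linearPl ?linearPr.
Qed.

HB.instance Definition _ := @bilinear_isBilinear.Build C (subsp S) (subsp S) C
  _ _ subsp_dot subsp_dot_is_bilinear.

Lemma subsp_dot_hermitian u v :
  subsp_dot u v = (-1) ^+ false * Num.conj (subsp_dot v u).
Proof. exact: hermC. Qed.

HB.instance Definition _ := @isHermitianSesquilinear.Build C (subsp S) false
  Num.conj subsp_dot subsp_dot_hermitian.

Lemma subsp_dot_gt0 u : u != 0 -> 0 < subsp_dot u u.
Proof. by move=> u0; apply: neq0_dnorm_gt0; rewrite -(inj_eq val_inj) in u0. Qed.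

HB.instance Definition _ := @isDotProduct.Build C (subsp S) subsp_dot subsp_dot_gt0.

HB.instance Definition _ := Lmodule_isInnerProduct.Build C (subsp S) subsp_dot.

End SubspaceInner.

Section Ultraproduct.
Variables (U : set_system nat) (UU : UltraFilter U) (T : nat -> Type).

Definition pseq (T : nat -> Type) := forall N, T N.

HB.instance Definition _ (T' : nat -> Type) := gen_eqMixin (pseq T').
HB.instance Definition _ (T' : nat -> Type) := gen_choiceMixin (pseq T').

Definition ueq (x y : pseq T) : bool := `[< U [set N | x N = y N] >].

Lemma ueq_is_equiv : equiv_class_of ueq.
Proof.
split=> [x|x y|y x z].
- by apply/asboolP; apply: filterS filterT => N.
- by apply/asboolP/asboolP; apply: filterS => N /=.
move=> /asboolP xy /asboolP yz; apply/asboolP.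
by apply: filterS2 xy yz => N /= -> ->.
Qed.

Canonical ueq_equiv := EquivRelPack ueq_is_equiv.
Canonical ueq_encModRel := defaultEncModRel ueq.

Definition ultraproduct := {eq_quot ueq}.

HB.instance Definition _ : EqQuotient (pseq T) ueq ultraproduct :=
  EqQuotient.on ultraproduct.
HB.instance Definition _ := Choice.on ultraproduct.

Definition uclass (x : pseq T) : ultraproduct := \pi_ultraproduct x.

Lemma uclassP x y : uclass x = uclass y <-> U [set N | x N = y N].
Proof.
split=> [/eqmodP/asboolP //|xy]; exact/eqmodP/asboolP.
Qed.

Lemma repr_uclass x : U [set N | repr (uclass x) N = x N].
Proof. by apply/uclassP; rewrite /uclass reprK. Qed.

Lemma uclassW (P : ultraproduct -> Prop) : (forall x, P (uclass x)) -> forall x, P x.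
Proof. by move=> h x; rewrite -[x]reprK; apply: h. Qed.

End Ultraproduct.

(* Functions and relations on an ultraproduct are computed componentwise on
   representatives; [umapE], [umap2E] and [urelE] state the independence of
   the representatives. *)
Section UltraproductMaps.
Variables (U : set_system nat) (UU : UltraFilter U).
Variables (T1 T2 T3 : nat -> Type).

Definition umap (f : forall N, T1 N -> T2 N) (x : ultraproduct UU T1) :
    ultraproduct UU T2 :=
  uclass UU (fun N => f N (repr x N)).

Definition umap2 (f : forall N, T1 N -> T2 N -> T3 N)
    (x : ultraproduct UU T1) (y : ultraproduct UU T2) : ultraproduct UU T3 :=
  uclass UU (fun N => f N (repr x N) (repr y N)).

Definition urel (r : forall N, T1 N -> T2 N -> Prop)
    (x : ultraproduct UU T1) (y : ultraproduct UU T2) : Prop :=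
  U [set N | r N (repr x N) (repr y N)].

Lemma umapE f x : umap f (uclass UU x) = uclass UU (fun N => f N (x N)).
Proof.
by apply/uclassP; apply: filterS (repr_uclass UU x) => N /= ->.
Qed.

Lemma umap2E f x y :
  umap2 f (uclass UU x) (uclass UU y) = uclass UU (fun N => f N (x N) (y N)).
Proof.
apply/uclassP.
by apply: filterS2 (repr_uclass UU x) (repr_uclass UU y) => N /= -> ->.
Qed.

Lemma urelE r x y :
  urel r (uclass UU x) (uclass UU y) <-> U [set N | r N (x N) (y N)].
Proof.
split; apply: filterS3 (repr_uclass UU x) (repr_uclass UU y) => N /= -> ->;
  exact.
Qed.

End UltraproductMaps.

Section UltraproductModule.
Variables (U : set_system nat) (UU : UltraFilter U).
Variables (K : nzRingType) (V : nat -> lmodType K).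
Local Notation Vu := (ultraproduct UU V).

Definition uadd : Vu -> Vu -> Vu := umap2 (fun N (x y : V N) => x + y).
Definition uopp : Vu -> Vu := umap (fun N (x : V N) => - x).
Definition uzero : Vu := uclass UU (fun N => 0 : V N).
Definition uscale (a : K) : Vu -> Vu := umap (fun N (x : V N) => a *: x).

Lemma uaddA : associative uadd.
Proof.
elim/uclassW => x; elim/uclassW => y; elim/uclassW => z; rewrite /uadd !umap2E.
by apply/uclassP; apply: filterS filterT => N _ /=; rewrite addrA.
Qed.

Lemma uaddC : commutative uadd.
Proof.
elim/uclassW => x; elim/uclassW => y; rewrite /uadd !umap2E.
by apply/uclassP; apply: filterS filterT => N _ /=; rewrite addrC.
Qed.

Lemma uadd0 : left_id uzero uadd.
Proof.
elim/uclassW => x; rewrite /uadd umap2E.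
by apply/uclassP; apply: filterS filterT => N _ /=; rewrite add0r.
Qed.

Lemma uaddN : left_inverse uzero uopp uadd.
Proof.
elim/uclassW => x; rewrite /uadd /uopp umapE umap2E.
by apply/uclassP; apply: filterS filterT => N _ /=; rewrite addNr.
Qed.

HB.instance Definition _ := GRing.isZmodule.Build Vu uaddA uaddC uadd0 uaddN.

Lemma uclassD (x y : pseq V) :
  uclass UU x + uclass UU y = uclass UU (fun N => x N + y N).
Proof. exact: umap2E. Qed.

Lemma uclassN (x : pseq V) : - uclass UU x = uclass UU (fun N => - x N).
Proof. exact: umapE. Qed.

Lemma uscaleA a b v : uscale a (uscale b v) = uscale (a * b) v.
Proof.
elim/uclassW: v => x; rewrite /uscale !umapE.
by apply/uclassP; apply: filterS filterT => N _ /=; rewrite scalerA.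
Qed.

Lemma uscale1 : left_id 1 uscale.
Proof.
elim/uclassW => x; rewrite /uscale umapE.
by apply/uclassP; apply: filterS filterT => N _ /=; rewrite scale1r.
Qed.

Lemma uscaleDr : right_distributive uscale +%R.
Proof.
move=> a; elim/uclassW => x; elim/uclassW => y.
rewrite /uscale uclassD !umapE uclassD.
by apply/uclassP; apply: filterS filterT => N _ /=; rewrite scalerDr.
Qed.

Lemma uscaleDl v : {morph uscale^~ v : a b / a + b}.
Proof.
move=> a b; elim/uclassW: v => x.
rewrite /uscale !umapE uclassD.
by apply/uclassP; apply: filterS filterT => N _ /=; rewrite scalerDl.
Qed.

HB.instance Definition _ :=
  GRing.Zmodule_isLmodule.Build K Vu uscaleA uscale1 uscaleDr uscaleDl.

Lemma uclassZ a (x : pseq V) : a *: uclass UU x = uclass UU (fun N => a *: x N).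
Proof. exact: umapE. Qed.

End UltraproductModule.

Section UltraLimits.
Variables (R : realType) (U : set_system nat) (UU : UltraFilter U).
Local Notation C := R[i].
Implicit Types (s : nat -> C) (z : C).

Definition ucvg s z := forall e : C, 0 < e -> U [set N | `|s N - z| < e].

Let ultra_lim_real (s : nat -> R) (k : R) : U [set N | `|s N| <= k] ->
  exists l : R, forall e : R, 0 < e -> U [set N | `|s N - l| < e].
Proof.
move=> sk.
have [|p [_ clp]] := @segment_compact R (- k) k (s @ U) _.
  change (U (s @^-1` `[- k, k]%classic)).
  by apply: filterS sk => N /= h; rewrite in_itv/= -ler_norml.
exists p => e e0.
have [//|nU] := in_ultra_setVsetC [set N | `|s N - p| < e] UU.
have [] := clp (~` [set x | `|x - p| < e]) [set x | `|x - p| < e].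
- exact: nU.
- by apply/nbhs_ballP; exists e => //= y; rewrite /ball/= distrC.
by move=> x [].
Qed.

Let complex_pos (e : C) : 0 < e -> e = (complex.Re e)%:C%C.
Proof. by case: e => x y; rewrite ltcE/= => /andP[/eqP -> _]. Qed.

Let normci : `|'i%C : C| = 1.
Proof. by rewrite normc_def/= expr0n expr1n add0r sqrtr1. Qed.

Lemma ucvg_bounded s (k : nat) : U [set N | `|s N| <= k%:R] ->
  exists z, ucvg s z.
Proof.
have kC : (k%:R : C) = (k%:R : R)%:C%C by rewrite rmorph_nat.
move=> sk.
have [|a ha] := @ultra_lim_real (fun N => complex.Re (s N)) k%:R.
  apply: filterS sk => N /= h; rewrite -lecR -kC.
  exact: le_trans (normc_ge_Re _) h.
have [|b hb] := @ultra_lim_real (fun N => complex.Im (s N)) k%:R.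
  apply: filterS sk => N /= h; rewrite -lecR -kC.
  apply: le_trans h; rewrite -normrN -ReiNIm.
  by apply: le_trans (normc_ge_Re _) _; rewrite normrM normci mulr1.
exists (Complex a b) => e e0.
have eR := complex_pos e0.
have e0' : 0 < complex.Re e / 2 by rewrite divr_gt0// -ltcR -eR.
apply: filterS2 (ha _ e0') (hb _ e0') => N /= h1 h2.
rewrite {}eR.
case: (s N) h1 h2 => x y /= h1 h2.
rewrite (_ : Complex x y - Complex a b = (x - a)%:C%C + 'i%C * (y - b)%:C%C); last first.
  by simpc.
apply: le_lt_trans (ler_normD _ _) _.
rewrite normrM normci mul1r !normc_def/= expr0n/= !addr0 !sqrtr_sqr -rmorphD/= ltcR.
by rewrite [ltRHS]splitr ltrD.
Qed.


Lemma ucvg_unique s z w : ucvg s z -> ucvg s w -> z = w.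
Proof.
move=> sz sw; apply/eqP; rewrite -subr_eq0 -normr_eq0.
apply: contraT; rewrite -normr_gt0 normr_id => zw.
have e0 : 0 < `|z - w| / 2 by rewrite divr_gt0.
have [N [/= h1 h2]] := filter_ex (filterI (sz _ e0) (sw _ e0)).
have : `|z - w| < `|z - w| / 2 + `|z - w| / 2.
  by rewrite (le_lt_trans (ler_distD (s N) _ _))// ltrD// distrC.
by rewrite -splitr ltxx.
Qed.

Lemma ucvgD s t z w : ucvg s z -> ucvg t w -> ucvg (fun N => s N + t N) (z + w).
Proof.
move=> sz tw e e0; have e2 : 0 < e / 2 by rewrite divr_gt0.
apply: filterS2 (sz _ e2) (tw _ e2) => N /= h1 h2.
rewrite opprD addrACA (le_lt_trans (ler_normD _ _))//.
by rewrite [ltRHS]splitr ltrD.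
Qed.

Lemma ucvgZ a s z : ucvg s z -> ucvg (fun N => a * s N) (a * z).
Proof.
move=> sz e e0; have a1 : 0 < `|a| + 1 by rewrite ltr_wpDl.
apply: filterS (sz (e / (`|a| + 1)) _) => [N /= h|]; last by rewrite divr_gt0.
rewrite -mulrBr normrM.
apply: (@le_lt_trans _ _ ((`|a| + 1) * `|s N - z|)).
  by rewrite ler_wpM2r// lerDl.
by rewrite mulrC -ltr_pdivlMr.
Qed.

Lemma ucvg_conj s z : ucvg s z -> ucvg (fun N => Num.conj (s N)) (Num.conj z).
Proof.
move=> sz e e0; apply: filterS (sz _ e0) => N /=.
by rewrite -rmorphB norm_conjC.
Qed.

Lemma ucvg_norm s z : ucvg s z -> ucvg (fun N => `|s N|) `|z|.
Proof.
move=> sz e e0; apply: filterS (sz _ e0) => N /=.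
exact: le_lt_trans (ler_dist_dist _ _).
Qed.

Lemma ucvg_ge0 s z : ucvg s z -> (forall N, 0 <= s N) -> 0 <= z.
Proof.
move=> sz s0; rewrite (ucvg_unique sz (w := `|z|))//.
by move=> e e0; apply: filterS (ucvg_norm sz e0) => N /=; rewrite (ger0_norm (s0 N)).
Qed.

Lemma ucvg_le s t z : ucvg t 0 -> U [set N | `|s N - z| <= t N] -> ucvg s z.
Proof.
move=> t0 st e e0; apply: filterS2 st (t0 _ e0) => N /= h1.
rewrite subr0 ger0_norm; first exact: le_lt_trans.
exact: le_trans (normr_ge0 _) h1.
Qed.

End UltraLimits.

(* Ultrapowers of the complex numbers.  As everywhere in MathComp, order and
   norm of complex numbers live in [R[i]] itself: [x <= y] on [R[i]] means that
   [y - x] is a nonnegative real. *)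
Section Hypercomplex.
Variables (R : realType) (U : set_system nat) (UU : UltraFilter U).
Local Notation C := R[i].

Definition hypercomplex := ultraproduct UU (fun=> C).

Definition standard (c : C) : hypercomplex := uclass UU (fun=> c).

Definition hle : hypercomplex -> hypercomplex -> Prop :=
  urel (fun _ (x y : C) => x <= y).

Definition hlt : hypercomplex -> hypercomplex -> Prop :=
  urel (fun _ (x y : C) => x < y).

Definition hnorm : hypercomplex -> hypercomplex := umap (fun _ (x : C) => `|x|).

Definition hsub : hypercomplex -> hypercomplex -> hypercomplex :=
  umap2 (fun _ (x y : C) => x - y).

Definition infinitesimal (x : hypercomplex) : Prop :=
  forall e : C, 0 < e -> hlt (hnorm x) (standard e).

(* the default 0 is only reached for infinite [x] *)
Definition standard_part (x : hypercomplex) : C :=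
  xget 0 [set z | infinitesimal (hsub x (standard z))].

Lemma infinitesimalP (s : nat -> C) : infinitesimal (uclass UU s) <->
  ucvg U s 0.
Proof.
rewrite /infinitesimal /hlt /standard /hnorm umapE; split=> h e /h.
  by move/urelE; apply: filterS => N /=; rewrite subr0.
by move=> h1; apply/urelE; apply: filterS h1 => N /=; rewrite subr0.
Qed.

Lemma standard_partE (s : nat -> C) z : ucvg U s z ->
  standard_part (uclass UU s) = z.
Proof.
have h w : infinitesimal (hsub (uclass UU s) (standard w)) <-> ucvg U s w.
  rewrite /hsub umap2E; split=> [/infinitesimalP|sw].
    by move=> + e e0 => /(_ e e0); apply: filterS => N /=; rewrite subr0.
  by apply/infinitesimalP => e /sw; apply: filterS => N /=; rewrite subr0.
move=> sz; rewrite /standard_part; case: xgetP => [y _ /h sy|/(_ z)/h//].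
exact: ucvg_unique sy sz.
Qed.

End Hypercomplex.

Section Hull.
Variables (R : realType) (U : set_system nat) (UU : UltraFilter U).
Local Notation C := R[i].
Variable V : nat -> innerProductType C.
Local Notation Vu := (ultraproduct UU V).

Definition unorm : Vu -> hypercomplex R UU := umap (fun N (x : V N) => `|x|).

Definition uinner : Vu -> Vu -> hypercomplex R UU :=
  umap2 (fun N (x y : V N) => inner x y).

Definition ufinite : {pred Vu} := fun v =>
  `[< exists k : nat, hle (unorm v) (standard UU k%:R) >].

Lemma ufiniteP (x : pseq V) :
  reflect (exists k : nat, U [set N | `|x N| <= k%:R]) (uclass UU x \in ufinite).
Proof.
have E k : hle (unorm (uclass UU x)) (standard UU k%:R) <->
    U [set N | `|x N| <= k%:R].
  by rewrite /unorm umapE; exact: urelE.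
by apply: (iffP (asboolP _)) => -[k /E xk]; exists k.
Qed.

Lemma ufinite_submod_closed : submod_closed ufinite.
Proof.
split=> [|a].
  apply/ufiniteP; exists 0%N; apply: filterS filterT => N _ /=.
  by rewrite normr0.
elim/uclassW => x; elim/uclassW => y /ufiniteP[k xk] /ufiniteP[l yl].
rewrite uclassZ uclassD; apply/ufiniteP.
have [m am] : exists m : nat, `|a| <= m%:R.
  exists (Num.bound (complex.Re `|a|)).
  rewrite -[leLHS]RRe_real ?normr_real// -(rmorph_nat (real_complex R)) lecR.
  by apply/ltW/archi_boundP; rewrite normc_def/= sqrtr_ge0.
exists (m * k + l)%N; apply: filterS2 xk yl => N /= h1 h2.
rewrite (le_trans (ler_normD _ _))// natrD lerD// normrZ natrM.
by rewrite ler_pM.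
Qed.

HB.instance Definition _ := GRing.isSubmodClosed.Build C Vu ufinite
  (GRing.submod_closed_semi ufinite_submod_closed).

(* [hull] below is the quotient by [usmall], i.e. u and v are identified when
   the ultraproduct norm of u - v is infinitesimal. *)
Definition usmall : {pred subsp ufinite} := fun v =>
  `[< infinitesimal (unorm (val v)) >].

Lemma usmall_submod_closed : submod_closed usmall.
Proof.
split=> [|a u v /asboolP + /asboolP +]; last first.
  move=> hu hv; apply/asboolP; move: hu hv.
  rewrite (_ : val (a *: u + v) = a *: val u + val v)//.
  elim/uclassW: (val u) => x; elim/uclassW: (val v) => y.
  rewrite uclassZ uclassD /unorm !umapE.
  move=> /infinitesimalP xs /infinitesimalP ys; apply/infinitesimalP.
  have := ucvgD UU (ucvgZ UU `|a| xs) ys; rewrite mulr0 addr0.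
  move=> + e e0 => /(_ e e0); apply: filterS => N /=.
  rewrite !subr0 normr_id; apply: le_lt_trans.
  rewrite (le_trans (ler_normD _ _))// normrZ.
  by rewrite [leRHS]ger0_norm// addr_ge0// mulr_ge0.
apply/asboolP; rewrite (_ : val 0 = uclass UU (fun N => 0 : V N))//.
rewrite /unorm umapE; apply/infinitesimalP => e e0.
by apply: filterS filterT => N _ /=; rewrite normr0 subr0 normr0.
Qed.

HB.instance Definition _ := GRing.isSubmodClosed.Build C (subsp ufinite) usmall
  (GRing.submod_closed_semi usmall_submod_closed).

Definition hull := @Quotient.quot _ usmall.

HB.instance Definition _ := GRing.Zmodule.on hull.
HB.instance Definition _ := EqQuotient.on hull.

End Hull.

Lemma CauchySchwarz (C : numClosedFieldType) (V : innerProductType C)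
    (u v : V) :
  `|inner u v| <= `|u| * `|v|.
Proof.
have n (w : V) : dnorm dotp w = `|w| by rewrite /dnorm -normr_dotp sqrCK.
by rewrite mulrC -!n; exact: dot_CauchySchwarz.
Qed.

Section HullModule.
Variables (R : realType) (U : set_system nat) (UU : UltraFilter U).
Local Notation C := R[i].
Variable V : nat -> innerProductType C.
Local Notation Vu := (ultraproduct UU V).
Local Notation hull := (hull UU V).

(* meaningful only for finite [v]; the default is the class of 0 *)
Definition hull_class (v : Vu) : hull := \pi_hull (insubd 0 v).

Let hull_eqP (x y : subsp (@ufinite R U UU V)) :
  \pi_hull x = \pi_hull y <-> x - y \in @usmall R U UU V.
Proof.
rewrite (Quotient.idealrBE (@usmall R U UU V)).
by split=> [/eqP//|/eqP].
Qed.

Lemma hull_classP (x y : pseq V) :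
  uclass UU x \in @ufinite R U UU V -> uclass UU y \in @ufinite R U UU V ->
  hull_class (uclass UU x) = hull_class (uclass UU y) <->
  ucvg U (fun N => `|x N - y N|) 0.
Proof.
move=> fx fy.
have E : val (insubd (0 : subsp (@ufinite R U UU V)) (uclass UU x) -
    insubd 0 (uclass UU y)) =
    uclass UU (fun N => x N - y N).
  rewrite (_ : val (_ - _) =
    val (insubd (0 : subsp (@ufinite R U UU V)) (uclass UU x)) -
    val (insubd (0 : subsp (@ufinite R U UU V)) (uclass UU y)))//.
  by rewrite !insubdK// uclassN uclassD.
split=> [/hull_eqP/asboolP|xy].
  by rewrite E /unorm umapE => /infinitesimalP.
by apply/hull_eqP/asboolP; rewrite E /unorm umapE; exact/infinitesimalP.
Qed.

Lemma hullW (P : hull -> Prop) :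
  (forall x : pseq V, uclass UU x \in @ufinite R U UU V ->
    P (hull_class (uclass UU x))) ->
  forall h, P h.
Proof.
move=> hP h; rewrite -[h]reprK.
have : val (repr h) \in @ufinite R U UU V by case: (repr h).
rewrite -[X in \pi X](valKd 0) -/(hull_class _).
by elim/uclassW: (val (repr h)) => x; exact: hP.
Qed.

Lemma repr_hull_class (x : pseq V) : uclass UU x \in @ufinite R U UU V ->
  exists2 y : pseq V, val (repr (hull_class (uclass UU x))) = uclass UU y &
    uclass UU y \in @ufinite R U UU V /\ ucvg U (fun N => `|x N - y N|) 0.
Proof.
move=> fx; set h := hull_class _.
have [y yE] : exists y, val (repr h) = uclass UU y.
  by elim/uclassW: (val (repr h)) => y; exists y.
have fy : uclass UU y \in @ufinite R U UU V.
  by rewrite -yE; case: (repr h).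
exists y => //; split=> //; apply/hull_classP => //.
by rewrite -yE /hull_class valKd reprK.
Qed.

Lemma hull_classD (x y : pseq V) :
  uclass UU x \in @ufinite R U UU V -> uclass UU y \in @ufinite R U UU V ->
  hull_class (uclass UU x) + hull_class (uclass UU y) =
  hull_class (uclass UU (fun N => x N + y N)).
Proof.
move=> fx fy; rewrite /hull_class.
rewrite -[LHS](@Quotient.pi_add _ (@usmall R U UU V)).
congr (\pi_hull _); apply: val_inj.
rewrite (_ : val (_ + _) =
    val (insubd (0 : subsp (@ufinite R U UU V)) (uclass UU x)) +
    val (insubd (0 : subsp (@ufinite R U UU V)) (uclass UU y)))//.
by rewrite !insubdK -?uclassD ?rpredD.
Qed.

Definition hull_scale (a : C) (h : hull) : hull :=
  hull_class (a *: val (repr h)).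

Lemma hull_scaleE a (x : pseq V) : uclass UU x \in @ufinite R U UU V ->
  hull_scale a (hull_class (uclass UU x)) =
  hull_class (uclass UU (fun N => a *: x N)).
Proof.
move=> fx; rewrite /hull_scale.
have [y -> [fy xy]] := repr_hull_class fx.
rewrite uclassZ; apply/hull_classP; rewrite -?uclassZ ?rpredZ//.
move=> e e0; have := ucvgZ UU `|a| xy; rewrite mulr0 => /(_ e e0).
by apply: filterS => N /=; rewrite !subr0 -scalerBr [in X in _ -> X]normrZ
  [in X in _ -> X]distrC.
Qed.

Let fZ a (x : pseq V) : uclass UU x \in @ufinite R U UU V ->
  uclass UU (fun N => a *: x N) \in @ufinite R U UU V.
Proof. by move=> fx; rewrite -uclassZ rpredZ. Qed.

Let fD (x y : pseq V) :
  uclass UU x \in @ufinite R U UU V -> uclass UU y \in @ufinite R U UU V ->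
  uclass UU (fun N => x N + y N) \in @ufinite R U UU V.
Proof. by move=> fx fy; rewrite -uclassD rpredD. Qed.

Let uclass_ext (x y : pseq V) : (forall N, x N = y N) -> uclass UU x = uclass UU y.
Proof. by move=> xy; apply/uclassP; apply: filterS filterT => N _. Qed.

Lemma hull_scaleA a b v : hull_scale a (hull_scale b v) = hull_scale (a * b) v.
Proof.
elim/hullW: v => x fx; rewrite !hull_scaleE ?fZ//; congr hull_class.
by apply: uclass_ext => N; rewrite scalerA.
Qed.

Lemma hull_scale1 : left_id 1 hull_scale.
Proof.
elim/hullW => x fx; rewrite !hull_scaleE//; congr hull_class.
by apply: uclass_ext => N; rewrite scale1r.
Qed.

Lemma hull_scaleDr : right_distributive hull_scale +%R.
Proof.
move=> a; elim/hullW => x fx; elim/hullW => y fy.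
rewrite hull_classD// !hull_scaleE ?fD// hull_classD ?fZ//; congr hull_class.
by apply: uclass_ext => N; rewrite scalerDr.
Qed.

Lemma hull_scaleDl v : {morph hull_scale^~ v : a b / a + b}.
Proof.
move=> a b; elim/hullW: v => x fx.
rewrite !hull_scaleE// hull_classD ?fZ//; congr hull_class.
by apply: uclass_ext => N; rewrite scalerDl.
Qed.

HB.instance Definition _ := GRing.Zmodule_isLmodule.Build C hull
  hull_scaleA hull_scale1 hull_scaleDr hull_scaleDl.

Lemma hull_classZ a (x : pseq V) : uclass UU x \in @ufinite R U UU V ->
  a *: hull_class (uclass UU x) = hull_class (uclass UU (fun N => a *: x N)).
Proof. exact: hull_scaleE. Qed.

(* [inner] is linear in its second argument, the forms of the library in their
   first one, whence the swap *)
Definition hull_dot (g h : hull) : C :=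
  standard_part (uinner (val (repr h)) (val (repr g))).

Lemma hull_dotE (x y : pseq V) :
  uclass UU x \in @ufinite R U UU V -> uclass UU y \in @ufinite R U UU V ->
  ucvg U (fun N => inner (y N) (x N))
    (hull_dot (hull_class (uclass UU x)) (hull_class (uclass UU y))).
Proof.
move=> fx fy; rewrite /hull_dot.
have [x' -> [/ufiniteP[k x'k] xx']] := repr_hull_class fx.
have [y' -> [/ufiniteP[l y'l] yy']] := repr_hull_class fy.
have {fy}/ufiniteP[m ym] := fy.
rewrite /uinner umap2E.
have [|z yxz] := @ucvg_bounded R U UU (fun N => inner (y' N) (x' N)) (l * k).
  apply: filterS2 x'k y'l => N /= h1 h2.
  by rewrite natrM (le_trans (CauchySchwarz _ _))// ler_pM.
rewrite (standard_partE UU yxz).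
pose t N : C := m%:R * `|x N - x' N| + k%:R * `|y N - y' N| +
  `|inner (y' N) (x' N) - z|.
apply: (@ucvg_le _ _ UU _ t).
  have -> : (0 : C) = m%:R * 0 + k%:R * 0 + 0 by rewrite !mulr0 !addr0.
  apply: ucvgD; last first.
    by move=> e e0; apply: filterS (yxz e e0) => N /=; rewrite subr0 normr_id.
  by apply: ucvgD => //; apply: ucvgZ.
apply: filterS2 x'k ym => N /= h1 h2.
rewrite /t -[X in X - z](subrK (inner (y' N) (x' N))) -addrA.
rewrite (le_trans (ler_normD _ _))// lerD2r.
have -> : inner (y N) (x N) - inner (y' N) (x' N) =
    inner (y N) (x N - x' N) + inner (y N - y' N) (x' N).
  by rewrite /inner linearBl linearBr/= addrA subrK.
rewrite (le_trans (ler_normD _ _))// lerD//.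
  by rewrite (le_trans (CauchySchwarz _ _))// ler_wpM2r.
by rewrite (le_trans (CauchySchwarz _ _))// mulrC ler_wpM2r.
Qed.

Lemma hull_dot_is_bilinear :
  bilinear_for (GRing.Scale.Law.clone _ _ *%R _)
    (GRing.Scale.Law.clone _ _ (Num.conj \; *%R) _) hull_dot.
Proof.
split=> [v|u] a x y /=.
  elim/hullW: v => v fv; elim/hullW: x => x fx; elim/hullW: y => y fy.
  rewrite hull_classZ// hull_classD ?fZ//.
  apply: (ucvg_unique UU (hull_dotE _ fv)); first by rewrite fD ?fZ.
  have := ucvgD UU (ucvgZ UU a (hull_dotE fx fv)) (hull_dotE fy fv).
  move=> + e e0 => /(_ e e0); apply: filterS => N /=.
  by rewrite /inner linearPl.
elim/hullW: u => u fu; elim/hullW: x => x fx; elim/hullW: y => y fy.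
rewrite hull_classZ// hull_classD ?fZ//.
apply: (ucvg_unique UU (hull_dotE fu _)); first by rewrite fD ?fZ.
have := ucvgD UU (ucvgZ UU a^* (hull_dotE fu fx)) (hull_dotE fu fy).
move=> + e e0 => /(_ e e0); apply: filterS => N /=.
by rewrite /inner linearPr.
Qed.

HB.instance Definition _ := @bilinear_isBilinear.Build C hull hull C
  _ _ hull_dot hull_dot_is_bilinear.

Lemma hull_dot_hermitian g h :
  hull_dot g h = (-1) ^+ false * Num.conj (hull_dot h g).
Proof.
elim/hullW: g => x fx; elim/hullW: h => y fy; rewrite expr0 mul1r.
apply: (ucvg_unique UU (hull_dotE fx fy)).
have := ucvg_conj UU (hull_dotE fy fx).
move=> + e e0 => /(_ e e0); apply: filterS => N /=.
by rewrite [inner (y N) _]hermC expr0 mul1r.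
Qed.

HB.instance Definition _ := @isHermitianSesquilinear.Build C hull false
  Num.conj hull_dot hull_dot_hermitian.

Lemma hull_dot_gt0 h : h != 0 -> 0 < hull_dot h h.
Proof.
elim/hullW: h => x fx x0.
have xx := hull_dotE fx fx.
have : 0 <= hull_dot (hull_class (uclass UU x)) (hull_class (uclass UU x)).
  by apply: (ucvg_ge0 UU xx) => N; exact: dnorm_ge0.
rewrite le_eqVlt => /orP[/eqP h0|//]; exfalso; move/negP: x0; apply.
rewrite -h0 in xx.
have -> : 0 = hull_class (uclass UU (fun N => 0 : V N)).
  by rewrite -(scale0r (hull_class (uclass UU x))) hull_classZ//; congr hull_class;
     apply: uclass_ext => N; rewrite scale0r.
have f0 : uclass UU (fun N => 0 : V N) \in @ufinite R U UU V by exact: rpred0.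
apply/eqP; apply: (proj2 (hull_classP fx f0)).
move=> e e0; have /xx : 0 < e ^+ 2 by rewrite exprn_gt0.
apply: filterS => N /=; rewrite !subr0 normr_id /inner -normr_dotp normrX normr_id.
by rewrite ltr_pXn2r ?nnegrE ?normr_ge0 ?(ltW e0).
Qed.

HB.instance Definition _ := @isDotProduct.Build C hull hull_dot hull_dot_gt0.

HB.instance Definition _ := Lmodule_isInnerProduct.Build C hull hull_dot.

(* Independent of the representative when the [T N] are linear and uniformly
   bounded, see [hull_mapE]. *)
Definition hull_map (T : forall N, V N -> V N) (h : hull) : hull :=
  hull_class (umap T (val (repr h))).

Lemma hull_mapE (T : forall N, {linear V N -> V N}) (k : nat) (x : pseq V) :
  (forall N v, `|T N v| <= k%:R * `|v|) -> uclass UU x \in @ufinite R U UU V ->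
  hull_map T (hull_class (uclass UU x)) =
  hull_class (uclass UU (fun N => T N (x N))).
Proof.
move=> Tk fx; rewrite /hull_map.
have fT y : uclass UU y \in @ufinite R U UU V ->
    uclass UU (fun N => T N (y N)) \in @ufinite R U UU V.
  move=> /ufiniteP[l yl]; apply/ufiniteP; exists (k * l)%N.
  apply: filterS yl => N /= h; rewrite natrM (le_trans (Tk _ _))//.
  by rewrite ler_wpM2l.
have [y -> [fy xy]] := repr_hull_class fx.
rewrite umapE; apply/hull_classP; rewrite ?fT//.
apply: (@ucvg_le _ _ UU _ (fun N => k%:R * `|x N - y N|)).
  by have := ucvgZ UU k%:R xy; rewrite mulr0.
apply: filterS filterT => N _ /=.
by rewrite subr0 normr_id -linearB (le_trans (Tk _ _))// distrC.
Qed.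

End HullModule.

Section Operators.
Variables (R : realType) (H : hilbertType R[i]).
Implicit Types (T S : H -> H).

Definition separable := exists2 D : set H, countable D & dense D.

Definition bounded_op T := exists k : R[i], forall x, `|T x| <= k * `|x|.

(* meaningful for bounded operators only *)
Definition opnorm T : R :=
  sup [set complex.Re `|T x| | x in [set x : H | `|x| <= 1]].

Definition is_adjoint T S := forall x y, inner (S x) y = inner x (T y).

Definition self_adjoint T := is_adjoint T T.

(* the unique adjoint of [T], the constant 0 if there is none *)
Definition adjoint T : H -> H := xget (cst 0) [set S | is_adjoint T S].

Definition op_exp T : H -> H := fun x =>
  limn (series (fun k => k`!%:R^-1 *: iter k T x)).

(* P(T, S) x, where P = \sum_i P`_i X^i with coefficients P`_i in C[Y] *)
Definition poly2_op (P : {poly {poly R[i]}}) T S (x : H) : H :=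
  \sum_(i < size P) \sum_(j < size P`_i) P`_i`_j *: iter i T (iter j S x).

Definition cyclic_vector T (x : H) :=
  dense [set poly2_op P T (adjoint T) x | P in [set: {poly {poly R[i]}}]].

Section Krylov.
Variables (A : H -> H) (phi : H) (N : nat).
Let mono i j : H := iter i A (iter j (adjoint A) phi).

Definition HN : {pred H} :=
  linspan [set mono i j | i in [set i | (i <= N)%N] & j in [set j | (j <= N)%N]].

Definition HNminus : {pred H} :=
  linspan [set mono i j | i in [set i | (i < N)%N] & j in [set j | (j <= N)%N]].

Definition HNplus : {pred H} :=
  linspan [set mono i j | i in [set i | (0 < i <= N)%N] & j in [set j | (j <= N)%N]].

HB.instance Definition _ := GRing.SubmodClosed.on HN.

Definition Wminus : {pred H} := orthocomp HN HNminus.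
Definition Wplus : {pred H} := orthocomp HN HNplus.

HB.instance Definition _ := GRing.SubmodClosed.on Wminus.
HB.instance Definition _ := GRing.SubmodClosed.on Wplus.

End Krylov.

End Operators.

Definition unitary_map (C : numClosedFieldType) (V W : innerProductType C)
    (f : V -> W) :=
  bijective f /\ forall u v, inner (f u) (f v) = inner u v.

Definition orthonormal_basis (C : numClosedFieldType) (V : innerProductType C)
    (D : nat) (u : 'I_D -> V) :=
  (forall m n, inner (u m) (u n) = (m == n)%:R) /\
  linspan (range u) =i predT.

Section Spectral.
Variable R : realType.

Definition expi (q : R) : R[i] := Complex (cos q) (sin q).

Definition spectral_measure (D : nat) (lambda : 'I_D -> R[i]) (xi : 'I_D -> R)
    (X : set R[i]) : R :=
  \sum_(n < D | lambda n \in X) xi n ^+ 2.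

Definition square (M : nat) : set R[i] :=
  [set z | `|complex.Re z| <= M%:R /\ `|complex.Im z| <= M%:R].

Definition nice (mu : set R[i] -> R) (M : nat) (r : R) :=
  r \in `[- M%:R, M%:R] /\
  forall delta : R, 0 < delta -> exists2 eps : R, 0 < eps &
    mu [set z | square M z /\ `|complex.Re z - r| < eps] < delta /\
    mu [set z | square M z /\ `|complex.Im z - r| < eps] < delta.

End Spectral.

(* Main.v *)
Require Import Defs.
From HB Require Import structures.
From mathcomp Require Import all_boot all_order all_algebra.
From mathcomp Require Import sesquilinear.
From mathcomp Require Import all_classical all_reals all_analysis.
From mathcomp Require Import complex.
From mathcomp Require Import zify ring lra.
Set Implicit Arguments.
Unset Strict Implicit.
Unset Printing Implicit Defensive.
Import Order.TTheory GRing.Theory Num.Theory.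
Import numFieldNormedType.Exports.
Local Open Scope classical_set_scope.
Local Open Scope ring_scope.

(** In the eigenbases [u N], the operator B^m of the hull is multiplication by
    the arguments q in (-pi, pi] of the eigenvalues, and the operators A_N
    induce multiplication by exp(i q). As A_N agrees with A on H_N^-, and
    as every vector P(A, A')phi lies in H_N^- for N large, multiplication
    by exp(i q) extends A: it sends G v to G (A v), first on a dense set
    and then everywhere. What remains is to pass from an exponential to
    its logarithm, that is, to deduce B^m G = G B from exp(i B^m) G = G
    exp(i B); this is [hull_logarithm].

    The analogous identity for exp(- i B) comes for free. The operator A =
    exp(i B) is isometric, since G and multiplication by exp(i q) are; the
    operator A' = exp(- i B) is adjoint to A and commutes with it, so that
    A' is the inverse of A ([exp_adj_cancel]). Hence multiplication by cos
    q and sin q extends cos B and sin B.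

    An exponential determines its logarithm only up to the choice of a
    branch, and nothing keeps the eigenvalues of A_N away from -1. It is
    the vectors G v that have no mass there: as B is a contraction, 1 -
    cos B has norm at most cosh 1 - 1 < 11/20, whereas 1 - cos q >= 3/5
    for 5/4 < |q| <= pi, and high powers of (1 - cos q) / (3/5) show that
    the part of G v carried by |q| > 5/4 vanishes ([far_negligible]). So q
    may be truncated at 5/4, which turns B^m into an operator T of norm at
    most 5/4 that agrees with B^m on the range of G.

    Finally put X = T G - G B. Since T^n G - G B^n is the sum of the n
    operators T^j X B^(n-1-j), the sine series expresses sin T G - G sin
    B, which is 0, as X plus a remainder of norm at most (cosh (5/4) - 1)
    |X| <= 9/10 |X|; hence X = 0 ([sine_rigidity]). The number 5/4 is thus
    one among those r for which cosh 1 - 1 < 1 - cos r and cosh r < 2. *)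

(** * Real-valued norms *)

Section RealNorm.
Variable R : realType.

(** The norms of complex spaces take their values in [R[i]], whose order is only
    partial; with values in [R] the arithmetic of norms becomes linear real
    arithmetic. *)
Definition rnorm (V : normedZmodType R[i]) (v : V) : R := complex.Re `|v|.

Lemma rnormE (V : normedZmodType R[i]) (v : V) : `|v| = (rnorm v)%:C%C.
Proof. by rewrite -[LHS]RRe_real ?normr_real. Qed.

Lemma rnorm_ge0 (V : normedZmodType R[i]) (v : V) : 0 <= rnorm v.
Proof. by rewrite -lecR -rnormE; exact: normr_ge0. Qed.

Lemma rnormD (V : normedZmodType R[i]) (v w : V) :
  rnorm (v + w) <= rnorm v + rnorm w.
Proof. by rewrite -lecR rmorphD/= -!rnormE ler_normD. Qed.

Lemma rnorm0 (V : normedZmodType R[i]) : rnorm (0 : V) = 0.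
Proof. by rewrite /rnorm normr0. Qed.

Lemma rnormN (V : normedZmodType R[i]) (v : V) : rnorm (- v) = rnorm v.
Proof. by rewrite /rnorm normrN. Qed.

Lemma rnorm_eq0 (V : normedZmodType R[i]) (v : V) : rnorm v <= 0 -> v = 0.
Proof.
by rewrite -lecR -rnormE (_ : 0%:C%C = 0)// normr_le0 => /eqP.
Qed.

Lemma rnorm_sum (V : normedZmodType R[i]) I (r : seq I) (P : pred I)
    (F : I -> V) :
  rnorm (\sum_(i <- r | P i) F i) <= \sum_(i <- r | P i) rnorm (F i).
Proof.
rewrite -lecR -rnormE rmorph_sum/=; apply: le_trans (ler_norm_sum _ _ _) _.
by apply: ler_sum => i _; rewrite rnormE.
Qed.

Lemma rnormZ (V : normedModType R[i]) (a : R[i]) (v : V) :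
  rnorm (a *: v) = rnorm a * rnorm v.
Proof. by apply: (@complexI R); rewrite rmorphM/= -!rnormE normrZ. Qed.

Lemma rnormM (a b : R[i]) : rnorm (a * b) = rnorm a * rnorm b.
Proof. by apply: (@complexI R); rewrite rmorphM/= -!rnormE normrM. Qed.

Lemma rnormC (a : R) : rnorm (a%:C%C : R[i]) = `|a|.
Proof.
apply: (@complexI R); rewrite -rnormE normc_def/=.
by rewrite expr0n addr0 sqrtr_sqr.
Qed.

Lemma rnorm_nat n : rnorm (n%:R : R[i]) = n%:R.
Proof. by rewrite -(rmorph_nat (real_complex R)) rnormC ger0_norm. Qed.

Lemma rnormi : rnorm ('i%C : R[i]) = 1.
Proof. by rewrite /rnorm normc_def/= expr0n expr1n add0r sqrtr1. Qed.

Lemma rnormX (a : R[i]) n : rnorm (a ^+ n) = rnorm a ^+ n.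
Proof. by apply: (@complexI R); rewrite rmorphXn/= -!rnormE normrX. Qed.

Lemma rnormV (a : R[i]) : rnorm a^-1 = (rnorm a)^-1.
Proof. by apply: (@complexI R); rewrite fmorphV/= -!rnormE normfV. Qed.

Lemma real_part_pos (e : R[i]) :
  0 < e -> e = (complex.Re e)%:C%C /\ 0 < complex.Re e.
Proof.
case: e => x y; rewrite ltcE/= => /andP[/eqP -> x0]; split => //.
Qed.

Lemma rcvgP (V : normedModType R[i]) (u : nat -> V) (l : V) :
  u @ \oo --> l <->
  (forall e : R, 0 < e -> \forall n \near \oo, rnorm (l - u n) < e).
Proof.
split=> [/cvgrPdist_lt ul e e0|ul].
  have /ul : 0 < e%:C%C by rewrite ltcR.
  by apply: filterS => n /=; rewrite rnormE ltcR.
apply/cvgrPdist_lt => e /real_part_pos[-> /ul].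
by apply: filterS => n /=; rewrite rnormE ltcR.
Qed.

Lemma rcvg_le (V : normedModType R[i]) (u : nat -> V) (l : V) (k : R) :
  u @ \oo --> l -> (\forall n \near \oo, rnorm (u n) <= k) -> rnorm l <= k.
Proof.
move=> /rcvgP ul uk; apply/ler_addgt0Pr => e /ul ue.
have [n [/= h uk_n]] := filter_ex (filterI ue uk).
rewrite -(subrK (u n) l) (le_trans (rnormD _ _))// addrC.
by rewrite lerD// ltW.
Qed.

Lemma rcvg_lipschitz (V W : normedModType R[i]) (f : V -> W) (u : nat -> V)
    (l : V) (k : R) :
  (forall v w, rnorm (f v - f w) <= k * rnorm (v - w)) ->
  u @ \oo --> l -> (f \o u) @ \oo --> f l.
Proof.
move=> fk /rcvgP ul; apply/rcvgP => e e0.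
have k0 : 0 < `|k| + 1 by rewrite ltr_wpDl.
have /ul : 0 < e / (`|k| + 1) by rewrite divr_gt0.
apply: filterS => n /=; rewrite ltr_pdivlMr// mulrC; apply: le_lt_trans.
rewrite (le_trans (fk _ _))// ler_wpM2r ?rnorm_ge0//.
by rewrite (le_trans (ler_norm k))// lerDl.
Qed.

Lemma dense_lipschitz_eq (V W : normedModType R[i]) (D : set V)
    (f g : V -> W) (k : R) :
  dense D -> (forall v w, rnorm (f v - f w) <= k * rnorm (v - w)) ->
  (forall v w, rnorm (g v - g w) <= k * rnorm (v - w)) ->
  (forall v, D v -> f v = g v) -> forall v, f v = g v.
Proof.
move=> dD fk gk fgD v; apply/eqP; rewrite -subr_eq0; apply/eqP/rnorm_eq0.
apply/ler_addgt0Pr => e e0; rewrite add0r.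
have k0 : 0 < `|k| + 1 by rewrite ltr_wpDl.
have d0 : 0 < e / 2 / (`|k| + 1) by rewrite !divr_gt0.
have [||w [/= vw Dw]] := dD (ball v (e / 2 / (`|k| + 1))%:C%C).
- by exists v; apply: ballxx; rewrite ltcR.
- by apply: ball_open; rewrite ltcR.
have {}vw : rnorm (v - w) < e / 2 / (`|k| + 1).
  by move: vw; rewrite -ball_normE/= rnormE ltcR.
have kvw : k * rnorm (v - w) <= e / 2.
  move/ltW: vw; rewrite ler_pdivlMr// mulrC; apply: le_trans.
  rewrite ler_wpM2r ?rnorm_ge0//.
  by rewrite (le_trans (ler_norm k))// lerDl.
have -> : f v - g v = (f v - f w) - (g v - g w).
  by rewrite (fgD w Dw) opprB [RHS]addrA subrK.
rewrite (le_trans (rnormD _ _))// rnormN [leRHS]splitr lerD//.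
  exact: le_trans (fk _ _) kvw.
exact: le_trans (gk _ _) kvw.
Qed.

Lemma rcvg_uniq (V : normedModType R[i]) (u : nat -> V) (a b : V) :
  u @ \oo --> a -> u @ \oo --> b -> a = b.
Proof. exact: (cvg_unique (@norm_hausdorff _ _)). Qed.

Lemma linear_lipschitz (V W : normedModType R[i]) (f : {linear V -> W}) (k : R) :
  (forall v, rnorm (f v) <= k * rnorm v) ->
  forall v w, rnorm (f v - f w) <= k * rnorm (v - w).
Proof. by move=> fk v w; rewrite -linearB. Qed.

End RealNorm.

(** * Operators that are diagonal in an orthonormal basis *)
Section Inner.
Variables (R : realType) (V : innerProductType R[i]).

Lemma inner_is_scalar (u : V) : scalar (inner u).
Proof. by move=> a v w; rewrite /inner linearPl. Qed.

HB.instance Definition _ u := GRing.isLinear.Build R[i] V R[i] _ (inner u)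
  (inner_is_scalar u).

Lemma innerC (u v : V) : inner u v = (inner v u)^*.
Proof. by rewrite /inner hermC expr0 mul1r. Qed.

Lemma innerZr a (u v : V) : inner u (a *: v) = a * inner u v.
Proof. by rewrite linearZ. Qed.

Lemma innerZl a (u v : V) : inner (a *: u) v = a^* * inner u v.
Proof. by rewrite innerC innerZr [inner u v]innerC; exact: rmorphM. Qed.

Lemma innerDl (u v w : V) : inner (u + v) w = inner u w + inner v w.
Proof.
rewrite innerC linearD [inner u w]innerC [inner v w]innerC; exact: rmorphD.
Qed.

Lemma innerBl (u v w : V) : inner (u - v) w = inner u w - inner v w.
Proof.
rewrite innerC linearB [inner u w]innerC [inner v w]innerC; exact: rmorphB.
Qed.

Lemma inner_suml I (r : seq I) (P : pred I) (F : I -> V) (v : V) :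
  inner (\sum_(i <- r | P i) F i) v = \sum_(i <- r | P i) inner (F i) v.
Proof.
elim/big_rec2: _ => [|i _ x _ <-]; last exact: innerDl.
by rewrite -[0 in LHS](subrr v) innerBl subrr.
Qed.

Lemma inner_normE (v : V) : inner v v = (rnorm v ^+ 2)%:C%C.
Proof. by rewrite /inner -normr_dotp rnormE -rmorphXn. Qed.

Lemma rnorm_inner (u v : V) : rnorm (inner u v) <= rnorm u * rnorm v.
Proof. by rewrite -lecR rmorphM/= -!rnormE; exact: Defs.CauchySchwarz. Qed.

End Inner.

Section Diagonal.
Variables (R : realType) (V : innerProductType R[i]) (D : nat) (u : 'I_D -> V).

Definition diag (f : 'I_D -> R[i]) (v : V) : V :=
  \sum_n (f n * inner (u n) v) *: u n.

Lemma diag_is_linear f : linear (diag f).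
Proof.
move=> a v w; rewrite /diag scaler_sumr -big_split/=; apply: eq_bigr => n _.
by rewrite linearP/= mulrDr scalerDl scalerA mulrCA.
Qed.

HB.instance Definition _ f := GRing.isLinear.Build R[i] V V _ (diag f)
  (diag_is_linear f).

Lemma diagDf f g v : diag (fun n => f n + g n) v = diag f v + diag g v.
Proof.
rewrite /diag -big_split; apply: eq_bigr => n _ /=.
by rewrite mulrDl scalerDl.
Qed.

Lemma diagZf a f v : diag (fun n => a * f n) v = a *: diag f v.
Proof.
rewrite /diag scaler_sumr; apply: eq_bigr => n _ /=.
by rewrite -mulrA scalerA.
Qed.

Hypothesis u_basis : orthonormal_basis u.

Lemma diag_vect f m : diag f (u m) = f m *: u m.
Proof.
rewrite /diag (bigD1 m)//= (proj1 u_basis) eqxx mulr1 big1 ?addr0// => n nm.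
by rewrite (proj1 u_basis) (negbTE nm) mulr0 scale0r.
Qed.

Lemma basis_ext (f g : {linear V -> V}) : (forall n, f (u n) = g (u n)) -> f =1 g.
Proof.
move=> fg v; have : v \in linspan (range u) by rewrite (proj2 u_basis).
move=> /asboolP[n [c [x [xu ->]]]].
rewrite !linear_sum; apply: eq_bigr => i _; rewrite !linearZ/=.
by have [m _ <-] := xu i; rewrite fg.
Qed.

Lemma diag1 v : diag (fun=> 1) v = v.
Proof.
apply: (@basis_ext (diag (fun=> 1)) idfun) => n.
by rewrite /= diag_vect scale1r.
Qed.

Lemma inner_diag m f v : inner (u m) (diag f v) = f m * inner (u m) v.
Proof.
rewrite /diag linear_sum/= (bigD1 m)//= innerZr (proj1 u_basis) eqxx mulr1.
rewrite big1 ?addr0// => n nm.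
by rewrite innerZr (proj1 u_basis) eq_sym (negbTE nm) mulr0.
Qed.

Lemma diagM f g v : diag f (diag g v) = diag (fun n => f n * g n) v.
Proof. by apply: eq_bigr => n _; rewrite inner_diag mulrA. Qed.

Lemma parseval v : rnorm v ^+ 2 = \sum_n rnorm (inner (u n) v) ^+ 2.
Proof.
apply: (@complexI R); rewrite -inner_normE rmorph_sum -{2}(diag1 v).
rewrite /diag linear_sum/=; apply: eq_bigr => n _.
by rewrite innerZr mul1r [inner v _]innerC -normCK rnormE rmorphXn.
Qed.

Lemma rnorm_diag_le f g v : (forall n, rnorm (f n) <= rnorm (g n)) ->
  rnorm (diag f v) <= rnorm (diag g v).
Proof.
move=> fg; rewrite -(@ler_pXn2r _ 2)// ?nnegrE ?rnorm_ge0// !parseval.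
apply: ler_sum => n _; rewrite !inner_diag !rnormM.
by rewrite ler_pXn2r ?nnegrE ?mulr_ge0 ?rnorm_ge0// ler_wpM2r ?rnorm_ge0.
Qed.

Lemma rnorm_diag f (k : R) v : 0 <= k -> (forall n, rnorm (f n) <= k) ->
  rnorm (diag f v) <= k * rnorm v.
Proof.
move=> k0 fk; apply: (@le_trans _ _ (rnorm (diag (fun=> k%:C%C) v))).
  by apply: rnorm_diag_le => n; rewrite rnormC ger0_norm.
under [X in rnorm X]eq_bigr do rewrite -[k%:C%C]mulr1.
by rewrite -[X in rnorm X]/(diag _ _) diagZf diag1 rnormZ rnormC ger0_norm.
Qed.

End Diagonal.

(** * Functional calculus on the hull *)
Section HullCalculus.
Variables (R : realType) (U : set_system nat) (UU : UltraFilter U).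
Variables (V : nat -> innerProductType R[i]) (D : nat -> nat).
Variables (u : forall N, 'I_(D N) -> V N).
Arguments u : clear implicits.
Hypothesis u_basis : forall N, orthonormal_basis (u N).
Local Notation Hm := (hull UU V).
Local Notation symbol := (forall N, 'I_(D N) -> R[i]).
Local Notation finite x := (uclass UU x \in @ufinite R U UU V).
Implicit Types (f : symbol) (x y : pseq V) (h : Hm).

Definition bounded_symbol f := exists k : nat, forall N n, rnorm (f N n) <= k%:R.

Definition hull_diag f : Hm -> Hm := hull_map (fun N => diag (u N) (f N)).

Let diag_bound f (k : nat) : (forall N n, rnorm (f N n) <= k%:R) ->
  forall N v, `|diag (u N) (f N) v| <= k%:R * `|v|.
Proof.
move=> fk N v; rewrite !rnormE -(rmorph_nat (real_complex R)) -rmorphM/= lecR.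
by rewrite rnorm_diag.
Qed.

Lemma finite_diag f x : bounded_symbol f -> finite x ->
  finite (fun N => diag (u N) (f N) (x N)).
Proof.
move=> [k fk] /ufiniteP[l xl]; apply/ufiniteP; exists (k * l)%N.
apply: filterS xl => N /= h; rewrite natrM (le_trans (diag_bound fk _))//.
by rewrite ler_wpM2l.
Qed.

Lemma hull_diagE f x : bounded_symbol f -> finite x ->
  hull_diag f (hull_class (uclass UU x)) =
  hull_class (uclass UU (fun N => diag (u N) (f N) (x N))).
Proof.
move=> [k fk] fx.
exact: (@hull_mapE R U UU V (fun N => diag (u N) (f N)) k x (diag_bound fk) fx).
Qed.

Lemma hull_diag_is_linear f : bounded_symbol f -> linear (hull_diag f).
Proof.
move=> bf a; elim/hullW => x fx; elim/hullW => y fy.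
have fax : finite (fun N => a *: x N) by rewrite -uclassZ rpredZ.
have fs : finite (fun N => a *: x N + y N) by rewrite -uclassD rpredD.
rewrite hull_classZ// hull_classD// !hull_diagE// hull_classZ ?finite_diag//.
rewrite hull_classD ?finite_diag//; last first.
  by rewrite -uclassZ rpredZ// finite_diag.
congr hull_class; apply/uclassP; apply: filterS filterT => N _ /=.
by rewrite linearP.
Qed.

(** The norms of the hull are limits along the ultrafilter of the norms of the
    representatives. *)
Lemma hull_norm_le x y : finite x -> finite y ->
  (forall N, rnorm (x N) <= rnorm (y N)) ->
  rnorm (hull_class (uclass UU x)) <= rnorm (hull_class (uclass UU y)).
Proof.
move=> fx fy xy; rewrite -(@ler_pXn2r _ 2)// ?nnegrE ?rnorm_ge0//.
rewrite -lecR -!inner_normE -subr_ge0.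
have := ucvgD UU (hull_dotE fy fy) (ucvgZ UU (-1) (hull_dotE fx fx)).
rewrite mulN1r => /(ucvg_ge0 UU); apply => N.
rewrite mulN1r subr_ge0 !inner_normE lecR ler_pXn2r ?nnegrE ?rnorm_ge0//.
Qed.

(** Parseval's identity at each level N: comparing symbols plays the part of
    integrating against the spectral measures. *)
Lemma hull_diag_le f (g : symbol) h : bounded_symbol f -> bounded_symbol g ->
  (forall N n, rnorm (f N n) <= rnorm (g N n)) ->
  rnorm (hull_diag f h) <= rnorm (hull_diag g h).
Proof.
move=> bf bg fg; elim/hullW: h => x fx; rewrite !hull_diagE//.
by apply: hull_norm_le; rewrite ?finite_diag// => N; exact: rnorm_diag_le.
Qed.

Lemma hull_diag_ext f (g : symbol) h : (forall N n, f N n = g N n) ->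
  hull_diag f h = hull_diag g h.
Proof.
move=> fg; congr hull_diag.
by apply: functional_extensionality_dep => N; exact/funext.
Qed.

Lemma bounded_symbol_le f (k : R) : 0 <= k -> (forall N n, rnorm (f N n) <= k) ->
  bounded_symbol f.
Proof.
move=> k0 fk; exists (Num.bound k) => N n; apply: le_trans (fk N n) _.
by apply/ltW/archi_boundP.
Qed.

Lemma bounded_symbolM f (g : symbol) : bounded_symbol f -> bounded_symbol g ->
  bounded_symbol (fun N n => f N n * g N n).
Proof.
move=> [k fk] [l gl]; exists (k * l)%N => N n.
by rewrite rnormM natrM ler_pM ?rnorm_ge0.
Qed.

Lemma bounded_symbolD f (g : symbol) : bounded_symbol f -> bounded_symbol g ->
  bounded_symbol (fun N n => f N n + g N n).
Proof.
move=> [k fk] [l gl]; exists (k + l)%N => N n.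
by rewrite natrD (le_trans (rnormD _ _))// lerD.
Qed.

Lemma bounded_symbol_cst a : bounded_symbol (fun _ _ => a).
Proof. exact: (@bounded_symbol_le _ (rnorm a) (rnorm_ge0 a)). Qed.

Lemma bounded_symbolX f j : bounded_symbol f ->
  bounded_symbol (fun N n => f N n ^+ j).
Proof.
move=> [k fk]; exists (k ^ j)%N => N n.
by rewrite rnormX natrX lerXn2r ?nnegrE ?rnorm_ge0.
Qed.

Lemma hull_diagM f (g : symbol) h : bounded_symbol f -> bounded_symbol g ->
  hull_diag f (hull_diag g h) = hull_diag (fun N n => f N n * g N n) h.
Proof.
move=> bf bg; elim/hullW: h => x fx.
have bfg := bounded_symbolM bf bg.
rewrite !hull_diagE ?finite_diag//.
congr hull_class; apply/uclassP; apply: filterS filterT => N _ /=.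
by rewrite diagM.
Qed.

Lemma hull_diagD f (g : symbol) h : bounded_symbol f -> bounded_symbol g ->
  hull_diag (fun N n => f N n + g N n) h = hull_diag f h + hull_diag g h.
Proof.
move=> bf bg; elim/hullW: h => x fx.
have bfg := bounded_symbolD bf bg.
rewrite !hull_diagE ?finite_diag// hull_classD ?finite_diag//.
congr hull_class; apply/uclassP; apply: filterS filterT => N _ /=.
by rewrite diagDf.
Qed.

Lemma hull_diagZ a f h : bounded_symbol f ->
  hull_diag (fun N n => a * f N n) h = a *: hull_diag f h.
Proof.
move=> bf; elim/hullW: h => x fx.
have bfg := bounded_symbolM (bounded_symbol_cst a) bf.
rewrite !hull_diagE ?finite_diag// hull_classZ ?finite_diag//.
congr hull_class; apply/uclassP; apply: filterS filterT => N _ /=.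
by rewrite diagZf.
Qed.

Lemma hull_diag1 h : hull_diag (fun _ _ => 1) h = h.
Proof.
elim/hullW: h => x fx; rewrite !hull_diagE//; last exact: bounded_symbol_cst.
congr hull_class; apply/uclassP; apply: filterS filterT => N _ /=.
by rewrite diag1.
Qed.

Lemma rnorm_hull_diag f (k : R) h : 0 <= k -> (forall N n, rnorm (f N n) <= k) ->
  rnorm (hull_diag f h) <= k * rnorm h.
Proof.
move=> k0 fk.
have bk := bounded_symbol_cst k%:C%C.
have bf := bounded_symbol_le k0 fk.
apply: (@le_trans _ _ (rnorm (hull_diag (fun _ _ => k%:C%C) h))).
  by apply: hull_diag_le => // N n; rewrite rnormC ger0_norm.
rewrite (@hull_diag_ext (fun _ _ => k%:C%C) (fun _ _ => k%:C%C * 1)); last first.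
  by move=> ? ?; rewrite mulr1.
rewrite hull_diagZ ?hull_diag1 ?rnormZ ?rnormC ?ger0_norm//.
exact: bounded_symbol_cst.
Qed.

Lemma hull_diag_lipschitz f (k : R) g h : 0 <= k ->
  (forall N n, rnorm (f N n) <= k) ->
  rnorm (hull_diag f g - hull_diag f h) <= k * rnorm (g - h).
Proof.
move=> k0 fk; have bf := bounded_symbol_le k0 fk.
have -> : hull_diag f g - hull_diag f h = hull_diag f (g - h).
  by rewrite addrC [g - h]addrC -scaleN1r -[- h]scaleN1r hull_diag_is_linear.
exact: rnorm_hull_diag.
Qed.

Lemma hull_diagX f j h : bounded_symbol f ->
  iter j (hull_diag f) h = hull_diag (fun N n => f N n ^+ j) h.
Proof.
move=> bf; elim: j => [|j IH]; first by rewrite -[LHS]hull_diag1; exact: hull_diag_ext.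
rewrite iterS IH hull_diagM//; last exact: bounded_symbolX.
by apply: hull_diag_ext => N n; rewrite exprS.
Qed.

End HullCalculus.

(** * Estimates for the sine and cosine series *)
Section RealTrig.
Variable R : realType.
Implicit Types x : R.

(** A partial sum of cosh x - 1, which bounds the cosine series without its
    constant term and, in [sine_rigidity], the derivative of the sine series
    without its linear term. *)
Definition even_tail x J := \sum_(1 <= j < J) x ^+ j.*2 / j.*2`!%:R.

(** From the first term on, consecutive terms have a ratio of at most x^2 /
    12, so the sum is dominated by a geometric series. *)
Lemma even_tail_le x J : (1 - x ^+ 2 / 12) * even_tail x J <= x ^+ 2 / 2.
Proof.
pose t j : R := x ^+ j.*2 / j.*2`!%:R.
have t0 j : 0 <= t j by rewrite /t divr_ge0// -mul2n exprM exprn_ge0// sqr_ge0.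
have t1 : t 1%N = x ^+ 2 / 2 by rewrite /t.
have tS j : (0 < j)%N -> t j.+1 <= x ^+ 2 / 12 * t j.
  move=> j0; rewrite /t doubleS !factS !natrM (exprS x j.*2.+1) (exprS x j.*2).
  have -> : x * (x * x ^+ j.*2) / (j.*2.+2%:R * (j.*2.+1%:R * j.*2`!%:R)) =
      x ^+ 2 / (j.*2.+2%:R * j.*2.+1%:R) * (x ^+ j.*2 / j.*2`!%:R).
    by rewrite expr2 !invfM; ring.
  rewrite -/(t j) ler_wpM2r ?t0//; apply: ler_wpM2l; first exact: sqr_ge0.
  rewrite lef_pV2 ?posrE ?mulr_gt0 ?ltr0n//.
  by rewrite -natrM ler_nat; nia.
(* the last term is kept on the left so that the induction telescopes *)
suff : forall k, (1 - x ^+ 2 / 12) * even_tail x k.+1 + t k.+1 <= x ^+ 2 / 2.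
  case: J => [_|J /(_ J)]; last by have := t0 J.+1; lra.
  by rewrite /even_tail big_geq// mulr0 divr_ge0 ?sqr_ge0.
elim=> [|k IH]; first by rewrite /even_tail big_geq// mulr0 add0r t1.
rewrite /even_tail big_nat_recr//= -/(even_tail x k.+1) -/(t k.+1).
have := tS k.+1 isT; rewrite mulrDr mulrBl; lra.
Qed.

Lemma even_tail1 J : even_tail 1 J <= 11 / 20.
Proof. by have := even_tail_le 1 J; rewrite expr1n; lra. Qed.

Lemma even_tail54 J : even_tail (5 / 4) J <= 9 / 10.
Proof. by have := even_tail_le (5 / 4) J; rewrite expr2; lra. Qed.

(** The series of cos (5/4) is at most 1 - x^2 / 2 plus the absolute values of
    all the terms of degree at least 4. *)
Lemma cos54_le : cos (5 / 4 : R) <= 2 / 5.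
Proof.
apply: (cvgr_to_le (@cvg_cos_coeff' R (5 / 4))).
exists 2%N => // -[//|[//|J]] _.
apply: (@le_trans _ _ (1 - (5 / 4) ^+ 2 + even_tail (5 / 4) J.+2)); last first.
  by have := even_tail54 J.+2; rewrite expr2; lra.
rewrite /series/= big_ltn// big_ltn// /even_tail [in leRHS]big_ltn// /cos_coeff'.
rewrite -!exprnP !expr0 expr1 fact0 (_ : 1.*2`!%:R = 2)//.
have : \sum_(2 <= j < J.+2) (-1) ^ j * (5 / 4) ^+ j.*2 / j.*2`!%:R <=
   \sum_(2 <= j < J.+2) (5 / 4 : R) ^+ j.*2 / j.*2`!%:R.
  apply: ler_sum => j _; rewrite -exprnP ler_wpM2r// ler_piMl ?exprn_ge0//.
  by rewrite -signr_odd; case: (odd j); rewrite ?expr0 ?expr1//; lra.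
lra.
Qed.

Lemma cos_far x : 5 / 4 < `|x| -> `|x| <= pi -> cos x <= 2 / 5.
Proof.
move=> x1 x2; rewrite -cos_norm; apply: le_trans cos54_le; apply: ltW.
rewrite ltr_cos// in_itv/= ?x2 ?normr_ge0//.
by have := pi_ge2 R; lra.
Qed.

Lemma sin_coeff_le x j : `|x| <= 5 / 4 -> `|sin_coeff' x j| <= 2 * (1 / 2) ^+ j.
Proof.
move=> x54; rewrite /sin_coeff' -exprnP !normrM normrX normrN1 expr1n !mul1r.
rewrite normrX normfV normr_nat.
elim: j => [|j IH]; first by rewrite expr1 divr1 expr0 mulr1; lra.
rewrite doubleS !exprS !factS !natrM.
have -> : `|x| * (`|x| * (`|x| * `|x| ^+ j.*2)) /
   (j.*2.+3%:R * (j.*2.+2%:R * (j.*2.+1%:R * j.*2`!%:R))) =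
   `|x| ^+ 2 / (j.*2.+3%:R * j.*2.+2%:R) *
      (`|x| ^+ j.*2.+1 / j.*2.+1`!%:R).
  by rewrite expr2 factS natrM (exprS _ j.*2) !invfM; ring.
rewrite [leRHS]mulrCA; apply: ler_pM => //.
have x2 : `|x| ^+ 2 <= 2 by rewrite expr2; have x0 := normr_ge0 x; nra.
rewrite ler_pdivrMr ?mulr_gt0 ?ltr0n//.
have : (2 * 3 : R) <= j.*2.+3%:R * j.*2.+2%:R by rewrite -!natrM ler_nat; nia.
by lra.
Qed.

Lemma sin_tail x J : `|x| <= 5 / 4 ->
  `|sin x - \sum_(0 <= j < J) sin_coeff' x j| <= 4 * (1 / 2) ^+ J.
Proof.
move=> x54; have cvgs := @cvg_sin_coeff' R x.
apply: (cvgr_to_le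
  (cvg_norm (cvgB cvgs (cvg_cst (\sum_(0 <= j < J) sin_coeff' x j))))).
exists J => // K /= JK.
suff : forall k,
    `|series (sin_coeff' x) (J + k)%N - \sum_(0 <= j < J) sin_coeff' x j| <=
    4 * (1 / 2) ^+ J - 4 * (1 / 2) ^+ (J + k).
  move=> /(_ (K - J)%N); rewrite subnKC//.
  have : 0 <= (1 / 2 : R) ^+ K by rewrite exprn_ge0//; lra.
  by move=> ? /le_trans; apply; lra.
elim=> [|k IH]; first by rewrite addn0 /series/= !subrr normr0.
rewrite addnS /series/= big_nat_recr//= addrAC (le_trans (ler_normD _ _))//.
have := sin_coeff_le (J + k) x54; move: IH; rewrite /series/= exprS; lra.
Qed.

End RealTrig.

(** * The sine determines an operator of small norm *)
Section SineRigidity.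
Variable R : realType.

Definition sin_sum (V : lmodType R[i]) (T : V -> V) J (v : V) : V :=
  \sum_(0 <= j < J) ((-1) ^+ j / j.*2.+1`!%:R)%:C%C *: iter j.*2.+1 T v.

(** If sin T and sin S are intertwined by G, then so are T and S, provided
    that S is a contraction and T has norm at most 5/4. The defect T G - G
    S is bounded by C |v| for some C; comparing the sine series of both
    sides replaces C by 9/10 C, and iterating makes C arbitrarily small.
    The hypothesis is on partial sums, which make sense in any normed
    space W. *)
Lemma sine_rigidity (V W : normedModType R[i]) (G : {linear V -> W})
    (S : {linear V -> V}) (T : {linear W -> W}) :
  (forall v, rnorm (S v) <= rnorm v) ->
  (forall w, rnorm (T w) <= 5 / 4 * rnorm w) ->
  (exists2 k, 0 <= k & forall v, rnorm (G v) <= k * rnorm v) ->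
  (forall v e, 0 < e -> exists J,
    rnorm (sin_sum T J.+1 (G v) - G (sin_sum S J.+1 v)) <= e) ->
  forall v, T (G v) = G (S v).
Proof.
move=> S1 T54 [k k0 Gk] sinTS.
pose Q n v := iter n T (G v) - G (iter n S v).
have iS n v : rnorm (iter n S v) <= rnorm v.
  by elim: n => //= n IH; exact: le_trans (S1 _) IH.
(* the defect of the powers satisfies a recursion, whence the factor n in [Qn] *)
have QS n v : Q n.+1 v = T (Q n v) + Q 1%N (iter n S v).
  by rewrite /Q /= linearB addrA subrK.
have Qn C n v : 0 <= C -> (forall v, rnorm (Q 1%N v) <= C * rnorm v) ->
    5 / 4 * rnorm (Q n v) <= n%:R * (5 / 4) ^+ n * (C * rnorm v).
  move=> C0 QC; elim: n => [|n IH].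
    by rewrite /Q/= subrr rnorm0 mulr0 !mul0r.
  have p1 : 1 <= (5 / 4 : R) ^+ n by apply: exprn_ege1; lra.
  rewrite QS; have h1 := rnormD (T (Q n v)) (Q 1%N (iter n S v)).
  have h2 := T54 (Q n v).
  have h3 : rnorm (Q 1%N (iter n S v)) <= C * rnorm v.
    by apply: le_trans (QC _) _; rewrite ler_wpM2l.
  have Cv : 0 <= C * rnorm v by rewrite mulr_ge0 ?rnorm_ge0.
  have h4 : C * rnorm v <= (5 / 4 : R) ^+ n * (C * rnorm v).
    by rewrite ler_peMl.
  move: IH h1 h2 h3 h4; rewrite -(@natr1 _ n) exprS.
  set p := _ ^+ n; set c := C * _ => IH h1 h2 h3 h4.
  rewrite (_ : (n%:R + 1) * (5 / 4 * p) * c =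
    5 / 4 * (n%:R * p * c) + 5 / 4 * (p * c)); last by ring.
  lra.
(* the factor 2j+1 of [Qn] turns (2j+1)! into (2j)!, leaving cosh (5/4) - 1 *)
have contract C : 0 <= C -> (forall v, rnorm (Q 1%N v) <= C * rnorm v) ->
    forall v, rnorm (Q 1%N v) <= 9 / 10 * C * rnorm v.
  move=> C0 QC v; apply/ler_addgt0Pr => e /(sinTS v)[J].
  have -> : sin_sum T J.+1 (G v) - G (sin_sum S J.+1 v) =
      Q 1%N v + \sum_(1 <= j < J.+1)
        ((-1) ^+ j / j.*2.+1`!%:R)%:C%C *: Q j.*2.+1 v.
    rewrite /sin_sum linear_sum -sumrB big_ltn//; congr (_ + _).
      by rewrite linearZ -scalerBr expr0 (_ : 0.*2.+1`! = 1%N)// divr1 scale1r.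
    by apply: eq_bigr => j _; rewrite linearZ -scalerBr.
  set s := \sum_(1 <= j < _) _ => se.
  have h1 : rnorm s <= even_tail (5 / 4) J.+1 * (C * rnorm v).
    apply: le_trans (rnorm_sum _ _ _) _; rewrite mulr_suml; apply: ler_sum => j _.
    rewrite rnormZ rnormC normrM normrX normrN1 expr1n mul1r normfV normr_nat.
    rewrite factS natrM invfM.
    have := Qn C j.*2.+1 v C0 QC; rewrite exprS => h.
    have {}h : rnorm (Q j.*2.+1 v) <=
        j.*2.+1%:R * ((5 / 4) ^+ j.*2 * (C * rnorm v)).
      move: h; set q := rnorm _; set p := _ ^+ _; set c := C * _ => h.
      by rewrite -(@ler_pM2l _ (5 / 4)); lra.
    rewrite [leLHS](_ : _ =
      j.*2`!%:R^-1 * (rnorm (Q j.*2.+1 v) / j.*2.+1%:R)); last by ring.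
    rewrite [leRHS](_ : _ =
      j.*2`!%:R^-1 * ((5 / 4) ^+ j.*2 * (C * rnorm v))); last by ring.
    by rewrite ler_wpM2l ?invr_ge0// ler_pdivrMr ?ltr0n// mulrC.
  have h2 : rnorm s <= 9 / 10 * (C * rnorm v).
    by apply: le_trans h1 _; rewrite ler_wpM2r ?mulr_ge0 ?rnorm_ge0 ?even_tail54.
  rewrite -(addrK s (Q 1%N v)); apply: le_trans (rnormD _ _) _.
  by rewrite rnormN; lra.
have Q0 n v : rnorm (Q 1%N v) <= ((9 / 10) ^+ n * (9 / 4 * k)) * rnorm v.
  elim: n v => [|n IH] v.
    rewrite expr0 mul1r; apply: le_trans (rnormD _ _) _; rewrite rnormN /=.
    have h1 := T54 (G v); have h2 := Gk v; have h3 := Gk (S v).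
    have h4 : k * rnorm (S v) <= k * rnorm v by rewrite ler_wpM2l.
    lra.
  rewrite exprS -(mulrA (9 / 10)); apply: contract => //.
  by rewrite mulr_ge0 ?exprn_ge0 ?mulr_ge0//; lra.
move=> v; apply/eqP; rewrite -subr_eq0; apply/eqP/rnorm_eq0.
have c9 : `|9 / 10 : R| < 1 by rewrite ger0_norm; lra.
apply: (cvgr_to_ge (cvg_geometric (9 / 4 * k * rnorm v) c9)).
exists 0%N => // n _; apply: le_trans (Q0 n v) _.
by rewrite /geometric/= le_eqVlt; apply/orP; left; apply/eqP; ring.
Qed.

End SineRigidity.

(** * Exponentials of a contraction *)
Section Contraction.
Variables (R : realType) (H : hilbertType R[i]) (B : {linear H -> H}).

(** Boundedness ensures that the supremum which defines [opnorm] is the one of a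
    bounded set, and not a default value. *)
Lemma opnorm_contraction : bounded_op B -> opnorm B < 1 ->
  forall v, rnorm (B v) <= rnorm v.
Proof.
move=> [k Bk] B1 v.
have Bk' x : rnorm (B x) <= rnorm k * rnorm x.
  rewrite -lecR rmorphM/= -!rnormE.
  have kx0 : 0 <= k * `|x| by apply: le_trans (Bk x); exact: normr_ge0.
  by rewrite -[X in _ * X]normr_id -normrM ger0_norm.
have [v0|v0] := eqVneq v 0; first by rewrite v0 linear0.
have nv0 : 0 < rnorm v.
  rewrite lt_neqAle rnorm_ge0 andbT eq_sym; apply: contra_neq v0 => h.
  by apply: rnorm_eq0; rewrite h.
pose S := [set complex.Re `|B x| | x in [set x : H | `|x| <= 1]].
have S1 x : `|x| <= 1 -> rnorm (B x) <= 1.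
  move=> x1; apply: le_trans (ltW B1); apply: sup_upper_bound; last by exists x.
  split; first by exists (complex.Re `|B 0|); exists 0 => //=; rewrite normr0.
  exists (rnorm k) => _ [y /= y1 <-]; apply: le_trans (Bk' y) _.
  by rewrite ler_piMr ?rnorm_ge0// -lecR -rnormE.
have := S1 ((rnorm v)^-1%:C%C *: v).
rewrite linearZ/= rnormZ rnormC ger0_norm ?invr_ge0 ?rnorm_ge0//.
rewrite mulrC ler_pdivrMr// mul1r; apply.
rewrite rnormE rnormZ rnormC ger0_norm ?invr_ge0 ?rnorm_ge0//.
by rewrite mulVf ?gt_eqF.
Qed.

Hypothesis B1 : forall v, rnorm (B v) <= rnorm v.
Implicit Types (c d : R[i]) (v : H).

Definition exp_sum (c : R[i]) n (v : H) : H :=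
  \sum_(0 <= k < n) (c ^+ k / k`!%:R) *: iter k B v.

Lemma iter_scale c k v : iter k (fun v => c *: B v) v = c ^+ k *: iter k B v.
Proof.
elim: k => [|k IH]; first by rewrite expr0 scale1r.
by rewrite !iterS IH linearZ/= scalerA exprS.
Qed.

Lemma series_exp_sum c v :
  series (fun k => k`!%:R^-1 *: iter k (fun v => c *: B v) v) = exp_sum c ^~ v.
Proof.
apply/funext => n; apply: eq_bigr => k _.
by rewrite iter_scale scalerA mulrC.
Qed.

Lemma iter_contraction k v : rnorm (iter k B v) <= rnorm v.
Proof. by elim: k => //= k IH; exact: le_trans (B1 _) IH. Qed.

Let rnormV_fact k : rnorm (k`!%:R^-1 : R[i]) = k`!%:R^-1.
Proof. by rewrite rnormV rnorm_nat. Qed.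

Lemma exp_term_le c k v : rnorm c <= 1 ->
  rnorm ((c ^+ k / k`!%:R) *: iter k B v) <= k`!%:R^-1 * rnorm v.
Proof.
move=> c1; rewrite rnormZ rnormM rnormX rnormV_fact.
apply: ler_pM; rewrite ?mulr_ge0 ?invr_ge0 ?exprn_ge0 ?rnorm_ge0//.
  by rewrite ler_piMl ?invr_ge0 ?exprn_ile1 ?rnorm_ge0.
exact: iter_contraction.
Qed.

(** Term by term, the series is dominated by the real series of exp 1. *)
Lemma exp_sum_cvg c v : rnorm c <= 1 ->
  exp_sum c n v @[n --> \oo] --> op_exp (fun v => c *: B v) v.
Proof.
move=> c1; rewrite /op_exp series_exp_sum.
suff : cvgn (exp_sum c ^~ v) by [].
apply/cauchy_cvgP; rewrite -series_exp_sum; apply/cauchy_seriesP.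
move=> e /real_part_pos[-> e0].
have v1 : 0 < rnorm v + 1 by rewrite ltr_wpDl ?rnorm_ge0.
have /cauchy_cvgP/cauchy_seriesP := is_cvg_series_exp_coeff (1 : R).
have e1 : 0 < complex.Re e / (rnorm v + 1) by rewrite divr_gt0.
move=> /(_ _ e1); apply: filterS => -[m n] /=.
rewrite ltr_pdivlMr// => h; rewrite rnormE ltcR; apply: le_lt_trans h.
apply: (@le_trans _ _ ((\sum_(m <= k < n) k`!%:R^-1) * rnorm v)).
  apply: le_trans (rnorm_sum _ _ _) _; rewrite mulr_suml; apply: ler_sum => k _.
  by rewrite iter_scale scalerA mulrC exp_term_le.
rewrite ger0_norm; last by apply: sumr_ge0 => k _; rewrite exp_coeff_ge0.
apply: ler_pM; rewrite ?rnorm_ge0 ?lerDl//.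
  by apply: sumr_ge0 => k _; rewrite invr_ge0.
by apply: ler_sum => k _; rewrite /exp_coeff/= expr1n mul1r.
Qed.

Arguments exp_sum_cvg [c] v _.

Lemma exp_sum_is_linear c n : linear (exp_sum c n).
Proof.
move=> a v w; rewrite /exp_sum scaler_sumr -big_split/=; apply: eq_bigr => k _.
have iB j : iter j B (a *: v + w) = a *: iter j B v + iter j B w.
  by elim: j => //= j ->; rewrite linearP.
by rewrite iB scalerDr !scalerA mulrC.
Qed.

Lemma exp_sum_le c n v : rnorm c <= 1 -> rnorm (exp_sum c n v) <= expR 1 * rnorm v.
Proof.
move=> c1; apply: (@le_trans _ _ ((\sum_(0 <= k < n) k`!%:R^-1) * rnorm v)).
  apply: le_trans (rnorm_sum _ _ _) _; rewrite mulr_suml; apply: ler_sum => k _.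
  exact: exp_term_le.
rewrite ler_wpM2r ?rnorm_ge0//.
have cvg1 := is_cvg_series_exp_coeff (1 : R).
have nd : nondecreasing_seq (series (exp_coeff (1 : R))).
  by apply: nondecreasing_series => k _ _; rewrite exp_coeff_ge0.
apply: le_trans (nondecreasing_cvgn_le nd cvg1 n).
by apply: ler_sum => k _; rewrite /exp_coeff/= expr1n mul1r.
Qed.

Lemma op_exp_is_linear c : rnorm c <= 1 -> linear (op_exp (fun v => c *: B v)).
Proof.
move=> c1 a v w; apply: (rcvg_uniq (exp_sum_cvg (a *: v + w) c1)).
rewrite (_ : (fun n => _) = (fun n => a *: exp_sum c n v + exp_sum c n w)).
  by apply: cvgD; [apply: cvgZr; exact: exp_sum_cvg|exact: exp_sum_cvg].
by apply/funext => n; rewrite exp_sum_is_linear.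
Qed.

Lemma op_exp_le c v : rnorm c <= 1 ->
  rnorm (op_exp (fun v => c *: B v) v) <= expR 1 * rnorm v.
Proof.
move=> c1; apply: (rcvg_le (exp_sum_cvg v c1)).
by exists 0%N => // n _; exact: exp_sum_le.
Qed.

Definition op_expl c (c1 : rnorm c <= 1) : {linear H -> H} :=
  HB.pack_for {linear H -> H} (op_exp (fun v => c *: B v))
    (GRing.isLinear.Build R[i] H H _ (op_exp (fun v => c *: B v))
      (op_exp_is_linear c1)).

Lemma op_exp_commB c v : rnorm c <= 1 ->
  op_exp (fun v => c *: B v) (B v) = B (op_exp (fun v => c *: B v) v).
Proof.
move=> c1; apply: (rcvg_uniq (exp_sum_cvg (B v) c1)).
have B1' x : rnorm (B x) <= 1 * rnorm x by rewrite mul1r.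
have := rcvg_lipschitz (linear_lipschitz B1') (exp_sum_cvg v c1).
rewrite (_ : B \o _ = fun n => exp_sum c n (B v))//.
apply/funext => n /=; rewrite /exp_sum linear_sum; apply: eq_bigr => k _.
by rewrite linearZ/= -iterS iterSr.
Qed.

(** The partial sums of exp(c B) are polynomials in B, so they commute with
    exp(d B). *)
Lemma op_exp_comm c d v : rnorm c <= 1 -> rnorm d <= 1 ->
  op_exp (fun v => c *: B v) (op_exp (fun v => d *: B v) v) =
  op_exp (fun v => d *: B v) (op_exp (fun v => c *: B v) v).
Proof.
move=> c1 d1; apply: (rcvg_uniq (exp_sum_cvg _ c1)).
have dl x : rnorm (op_expl d1 x) <= expR 1 * rnorm x by exact: op_exp_le.
have := rcvg_lipschitz (linear_lipschitz dl) (exp_sum_cvg v c1).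
rewrite (_ : op_expl d1 \o _ =
  fun n => exp_sum c n (op_exp (fun v => d *: B v) v))//.
apply/funext => n; rewrite /comp /exp_sum linear_sum; apply: eq_bigr => k _.
rewrite linearZ/=; congr (_ *: _).
by elim: k => //= k IH; rewrite op_exp_commB// IH.
Qed.

Lemma op_exp_adjoint c : rnorm c <= 1 -> self_adjoint B ->
  is_adjoint (op_exp (fun v => c *: B v)) (op_exp (fun v => c^* *: B v)).
Proof.
move=> c1 Bsa x y.
have cc1 : rnorm c^* <= 1 by rewrite /rnorm norm_conjC.
have dc n : inner (exp_sum c^* n x) y = inner x (exp_sum c n y).
  rewrite /exp_sum inner_suml linear_sum; apply: eq_bigr => k _.
  have -> : c^* ^+ k / k`!%:R = (c ^+ k / k`!%:R)^*.
    rewrite [RHS]rmorphM; congr (_ * _); first by rewrite [RHS]rmorphXn.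
    by rewrite [RHS]fmorphV rmorph_nat.
  rewrite /= innerZl innerZr conjCK.
  congr (_ * _); elim: k y => //= k IH y.
  by rewrite Bsa IH -iterS iterSr.
have ix : forall v w, rnorm (inner x v - inner x w) <= rnorm x * rnorm (v - w).
  by move=> v w; rewrite -linearB; exact: rnorm_inner.
have iy : forall v w, rnorm (inner v y - inner w y) <= rnorm y * rnorm (v - w).
  by move=> v w; rewrite -innerBl mulrC; exact: rnorm_inner.
have hx := rcvg_lipschitz (V := H) (W := R[i]^o) ix (exp_sum_cvg y c1).
have hy := rcvg_lipschitz (V := H) (W := R[i]^o) iy (exp_sum_cvg x cc1).
have hxy : (fun v : H => inner v y) \o (exp_sum c^* ^~ x) =
    inner x \o (exp_sum c ^~ y).
  by apply/funext => n; exact: dc.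
rewrite hxy in hy; exact: (cvg_unique (@norm_hausdorff _ R[i]^o) hy hx).
Qed.

End Contraction.

(** * Sine and cosine of a contraction *)
Section Trig.
Variables (R : realType) (H : hilbertType R[i]) (B : {linear H -> H}).
Hypothesis B1 : forall v, rnorm (B v) <= rnorm v.
Let ep := op_exp (fun v => 'i%C *: B v).
Let em := op_exp (fun v => - 'i%C *: B v).

Let i1 : rnorm ('i%C : R[i]) <= 1. Proof. by rewrite rnormi. Qed.
Let mi1 : rnorm (- 'i%C : R[i]) <= 1. Proof. by rewrite rnormN rnormi. Qed.

Definition cos_sum J v : H :=
  \sum_(0 <= j < J) ((-1) ^+ j / j.*2`!%:R)%:C%C *: iter j.*2 B v.

(** Cutting the exponential series after an even number of terms is what makes
    the partial sums of sine and cosine match exactly. *)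
Lemma exp_sum_double (c : R[i]) J v : c ^+ 2 = -1 ->
  exp_sum B c J.*2 v = cos_sum J v + c *: sin_sum B J v.
Proof.
move=> c2.
have coef j n : ((-1) ^+ j / n%:R)%:C%C = (-1) ^+ j / n%:R :> R[i].
  by rewrite rmorphM fmorphV rmorphXn rmorphN1 rmorph_nat.
elim: J => [|J IH].
  by rewrite /exp_sum /cos_sum /sin_sum !big_geq// scaler0 addr0.
rewrite /exp_sum /cos_sum /sin_sum doubleS; do 4!(rewrite big_nat_recr//=).
rewrite -/(exp_sum B c J.*2 v) -/(cos_sum J v) -/(sin_sum B J v) IH.
rewrite scalerDr scalerA -!addrA; congr (_ + _); rewrite addrCA; congr (_ + _).
  by rewrite coef -mul2n exprM c2.
by rewrite coef exprS -mul2n exprM c2 mulrA.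
Qed.

Lemma double_cvg c v : rnorm c <= 1 ->
  exp_sum B c J.*2 v @[J --> \oo] --> op_exp (fun v => c *: B v) v.
Proof.
move=> c1; apply/rcvgP => e e0.
have /rcvgP/(_ _ e0)[m _ h] := @exp_sum_cvg _ _ _ B1 c v c1.
exists m => // n /= mn; apply: h => /=.
by rewrite (leq_trans mn)// -addnn leq_addr.
Qed.

Lemma sin_sum_cvg v : sin_sum B J v @[J --> \oo] --> (2 * 'i%C)^-1 *: (ep v - em v).
Proof.
rewrite (_ : (fun J => _) = (fun J => (2 * 'i%C)^-1 *:
    (exp_sum B 'i%C J.*2 v - exp_sum B (- 'i%C) J.*2 v))); last first.
  apply/funext => J; rewrite !exp_sum_double ?sqrrN ?sqr_i//.
  have ii : 'i%C + 'i%C = 2 * 'i%C :> R[i] by rewrite mulr_natl mulr2n.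
  rewrite opprD addrACA subrr add0r scaleNr opprK -scalerDl ii scalerA.
  rewrite mulVf ?scale1r//.
  by rewrite mulf_neq0// ?pnatr_eq0// -normr_gt0 rnormE rnormi ltcR.
by apply: cvgZr; apply: cvgB; exact: double_cvg.
Qed.

(** The bound is cosh 1 - 1, rounded up. *)
Lemma one_sub_cos_le v : rnorm (v - 2^-1 *: (ep v + em v)) <= 11 / 20 * rnorm v.
Proof.
have cosE J : 2^-1 *: (exp_sum B 'i%C J.*2 v + exp_sum B (- 'i%C) J.*2 v) =
    cos_sum J v.
  rewrite !exp_sum_double ?sqrrN ?sqr_i// addrACA -scalerDl subrr scale0r addr0.
  by rewrite -[cos_sum J v]scale1r -scalerDl scalerA mulVf ?pnatr_eq0.
have cvgc : v - cos_sum J v @[J --> \oo] --> v - 2^-1 *: (ep v + em v).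
  under eq_fun do rewrite -cosE.
  apply: cvgB; first exact: cvg_cst.
  by apply: cvgZr; apply: cvgD; exact: double_cvg.
apply: (rcvg_le cvgc); exists 1%N => // -[//|J] _ /=.
rewrite /cos_sum big_ltn// expr0 fact0 divr1 scale1r opprD addrA subrr sub0r rnormN.
apply: le_trans (rnorm_sum _ _ _) _.
apply: (@le_trans _ _ (even_tail 1 J.+1 * rnorm v)); last first.
  by rewrite ler_wpM2r ?rnorm_ge0 ?even_tail1.
rewrite mulr_suml; apply: ler_sum => j _.
rewrite rnormZ rnormC normrM normrX normrN1 expr1n normfV normr_nat expr1n.
rewrite ler_wpM2l ?divr_ge0//; exact: iter_contraction.
Qed.

End Trig.

(** * Points of the unit circle *)
Section Expi.
Variable R : realType.
Implicit Types q : R.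

Lemma expiE q : expi q = (cos q)%:C%C + 'i%C * (sin q)%:C%C.
Proof. by rewrite /expi; simpc. Qed.

Lemma expiN q : expi (- q) = (cos q)%:C%C - 'i%C * (sin q)%:C%C.
Proof. by rewrite expiE cosN sinN rmorphN mulrN. Qed.

Lemma rnorm_expi q : rnorm (expi q) = 1.
Proof. by rewrite /rnorm normc_def/= cos2Dsin2 sqrtr1. Qed.

Lemma expiNM q : expi (- q) * expi q = 1.
Proof.
rewrite expiN expiE -subr_sqr exprMn sqr_i mulN1r opprK -!rmorphXn -rmorphD.
by rewrite cos2Dsin2.
Qed.

Lemma i_neq0 : ('i%C : R[i]) != 0.
Proof. by rewrite -normr_gt0 rnormE rnormi ltcR. Qed.

End Expi.

(** * The logarithm on the hull *)
Section HullLogarithm.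
Variables (R : realType) (U : set_system nat) (UU : UltraFilter U).
Variables (V : nat -> innerProductType R[i]) (D : nat -> nat).
Variables (u : forall N, 'I_(D N) -> V N).
Arguments u : clear implicits.
Hypothesis u_basis : forall N, orthonormal_basis (u N).
Variable q : forall N, 'I_(D N) -> R.
Arguments q : clear implicits.
Hypothesis q_pi : forall N n, `|q N n| <= pi.
Variables (H : hilbertType R[i]) (B : {linear H -> H}).
Hypothesis B1 : forall v, rnorm (B v) <= rnorm v.
Hypothesis Bsa : self_adjoint B.
Local Notation Hm := (hull UU V : innerProductType R[i]).
Variable G : {linear H -> Hm}.
Hypothesis G_iso : forall v, rnorm (G v) = rnorm v.
Local Notation Phi := (@hull_diag R U UU V D u).
Local Notation A := (op_exp (fun v => 'i%C *: B v)).
Local Notation A' := (op_exp (fun v => - 'i%C *: B v)).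
Hypothesis AG : forall v, Phi (fun N n => expi (q N n)) (G v) = G (A v).

Local Notation bounded := (@bounded_symbol R D).

Let b_expi (s : R -> R) : bounded (fun N n => expi (s (q N n))).
Proof. by exists 1%N => N n; rewrite rnorm_expi. Qed.

Let i1 : rnorm ('i%C : R[i]) <= 1. Proof. by rewrite rnormi. Qed.
Let mi1 : rnorm (- 'i%C : R[i]) <= 1. Proof. by rewrite rnormN rnormi. Qed.

Let bc (a : R[i]) := bounded_symbol_cst D a.

(** G and multiplication by exp(i q) are isometric, and together they
    compute A. *)
Lemma exp_isometry v : rnorm (A v) = rnorm v.
Proof.
rewrite -G_iso -AG -[RHS]G_iso -[in RHS](hull_diag1 u_basis (G v)).
apply/eqP; rewrite eq_le; apply/andP; split; apply: hull_diag_le => //;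
  do ?[exact: bc|exact: (b_expi id)]; move=> N n;
  by rewrite rnorm_expi (rnorm_nat R 1).
Qed.

(** An isometry is cancelled on the left by its adjoint, and here the adjoint
    commutes with it. *)
Lemma exp_adj_cancel v : A (A' v) = v.
Proof.
have adj x y : inner (A' x) y = inner x (A y).
  have := op_exp_adjoint B1 i1 Bsa x y.
  by rewrite (_ : 'i%C^* = - 'i%C)// conjCi.
have A'1 w : rnorm (A' w) <= rnorm w.
  have h : rnorm (A' w) ^+ 2 <= rnorm w * rnorm (A' w).
    have := rnorm_inner w (A (A' w)); rewrite -adj exp_isometry inner_normE.
    by rewrite rnormC ger0_norm ?sqr_ge0.
  have [->|w0] := eqVneq (rnorm (A' w)) 0; first exact: rnorm_ge0.
  have w1 : 0 < rnorm (A' w) by rewrite lt_neqAle eq_sym w0 rnorm_ge0.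
  by rewrite -(ler_pM2r w1) -expr2.
rewrite op_exp_comm//; apply/eqP; rewrite -subr_eq0; apply/eqP/rnorm_eq0.
set w := A v.
have wv : inner w w = inner v v by rewrite !inner_normE /w exp_isometry.
have e1 : inner (A' w) v = inner v v by rewrite adj -/w wv.
have e2 : inner v (A' w) = inner v v by rewrite innerC e1 -innerC.
(* expanding |A' w - v|^2 leaves |A' w|^2 - |v|^2, which is at most 0 *)
have := inner_normE (A' w - v).
rewrite innerBl !linearB/= e1 e2 opprK addNr addr0 !inner_normE -rmorphB.
move=> /(@complexI R) h.
have : rnorm (A' w - v) ^+ 2 <= 0.
  rewrite -h subr_le0 ler_pXn2r ?nnegrE ?rnorm_ge0//.
  by apply: le_trans (A'1 w) _; rewrite /w exp_isometry.
by rewrite -[X in _ <= X -> _](expr0n R 2) ler_pXn2r ?nnegrE ?rnorm_ge0.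
Qed.

Lemma exp_adj_intertwine v : Phi (fun N n => expi (- q N n)) (G v) = G (A' v).
Proof.
rewrite -{1}(exp_adj_cancel v) -AG hull_diagM//; try exact: (b_expi id).
  by rewrite -[RHS](hull_diag1 u_basis); apply: hull_diag_ext => N n; rewrite expiNM.
Qed.


Let b_real (g : R -> R) (k : nat) : (forall N n, `|g (q N n)| <= k%:R) ->
  bounded (fun N n => (g (q N n))%:C%C).
Proof. by move=> gk; exists k => N n; rewrite rnormC. Qed.

Let Z v := v - 2^-1 *: (A v + A' v).

Let b_cos : bounded (fun N n => (1 - cos (q N n))%:C%C).
Proof.
apply: (b_real (g := fun x => 1 - cos x) (k := 2)) => N n.
rewrite ger0_norm; have := cos_le1 (q N n); have := cos_geN1 (q N n); lra.
Qed.

Lemma one_sub_cos_intertwine v :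
  Phi (fun N n => (1 - cos (q N n))%:C%C) (G v) = G (Z v).
Proof.
have bp := b_expi id; have bm := b_expi -%R.
rewrite /Z linearB linearZ linearD/= -AG -exp_adj_intertwine.
have bs := bounded_symbolD bp bm.
have b2 := bounded_symbolM (bc 2^-1) bs.
have b3 := bounded_symbolM (bc (-1)) b2.
rewrite -(hull_diagD u_basis _ bp bm) -(hull_diagZ u_basis _ _ bs) -scaleN1r.
rewrite -(hull_diagZ u_basis _ _ b2) -[X in X + _](hull_diag1 u_basis).
rewrite -(hull_diagD u_basis _ (bc 1) b3).
apply: hull_diag_ext => N n.
rewrite expiN expiE addrACA subrr addr0 rmorphB mulN1r; congr (_ - _).
by rewrite mulrDr ![2^-1 * _]mulrC -splitr.
Qed.

Lemma one_sub_cos_decay j v :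
  rnorm (Phi (fun N n => (1 - cos (q N n))%:C%C ^+ j) (G v)) <=
  (11 / 20) ^+ j * rnorm v.
Proof.
rewrite -(hull_diagX u_basis)//.
have -> : iter j (Phi (fun N n => (1 - cos (q N n))%:C%C)) (G v) = G (iter j Z v).
  by elim: j => //= j ->; exact: one_sub_cos_intertwine.
rewrite G_iso; elim: j => [|j IH]; first by rewrite expr0 mul1r.
rewrite iterS exprS -mulrA; apply: le_trans (one_sub_cos_le B1 _) _.
by rewrite ler_wpM2l.
Qed.

(** For every j, such an f is dominated by 4 (5/3 (1 - cos q))^j, whose operator
    maps G v to a vector of norm at most 4 (11/12)^j |v|. *)
Lemma far_negligible (f : forall N, 'I_(D N) -> R[i]) v :
  (forall N n, rnorm (f N n) <= 4) ->
  (forall N n, `|q N n| <= 5 / 4 -> f N n = 0) ->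
  Phi f (G v) = 0.
Proof.
move=> f4 f0; apply: rnorm_eq0.
have c9 : `|11 / 12 : R| < 1 by rewrite ger0_norm; lra.
apply: (cvgr_to_ge (cvg_geometric (4 * rnorm v) c9)).
exists 0%N => // j _; rewrite /geometric/=.
have bj := bounded_symbolX j b_cos.
pose a : R := 4 * (5 / 3) ^+ j.
apply: (@le_trans _ _ (rnorm
    (Phi (fun N n => a%:C%C * (1 - cos (q N n))%:C%C ^+ j) (G v)))).
  apply: (hull_diag_le u_basis).
  - by exists 4%N.
  - exact: (bounded_symbolM (bc _) bj).
  move=> N n; have c0 : 0 <= 1 - cos (q N n) by rewrite subr_ge0 cos_le1.
  have [le54|gt54] := leP `|q N n| (5 / 4); first by rewrite f0// rnorm0 rnorm_ge0.
  rewrite rnormM rnormX !rnormC (ger0_norm c0) ger0_norm; last first.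
    by rewrite mulr_ge0// exprn_ge0//; lra.
  rewrite /a -mulrA -exprMn; apply: le_trans (f4 N n) _.
  rewrite ler_peMr//; apply: exprn_ege1.
  by have := cos_far gt54 (q_pi n); lra.
rewrite (hull_diagZ u_basis)// rnormZ rnormC ger0_norm; last first.
  by rewrite mulr_ge0// exprn_ge0//; lra.
apply: (@le_trans _ _ (a * ((11 / 20) ^+ j * rnorm v))).
  rewrite ler_wpM2l ?one_sub_cos_decay// mulr_ge0// exprn_ge0//; lra.
have e9 : (11 / 12 : R) ^+ j = (5 / 3) ^+ j * (11 / 20) ^+ j.
  by rewrite -exprMn; congr (_ ^+ _); field.
by rewrite e9 /a le_eqVlt; apply/orP; left; apply/eqP; ring.
Qed.

Let truncate (x : R) : R := if `|x| <= 5 / 4 then x else 0.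

Let truncate_le x : `|truncate x| <= 5 / 4.
Proof. by rewrite /truncate; case: ifP => //; rewrite normr0 => _; lra. Qed.

Let b_truncate (g : R -> R) (k : nat) :
  (forall x, `|x| <= 5 / 4 -> `|g x| <= k%:R) ->
  bounded (fun N n => (g (truncate (q N n)))%:C%C).
Proof. by move=> gk; exists k => N n; rewrite rnormC gk. Qed.

Let pi4 : pi <= 4 :> R.
Proof. by have := (@pihalf_02 R); lra. Qed.

(** Truncation changes g (q) only where |q| > 5/4, which G v does not see. *)
Let truncate_intertwine (g : R -> R) v :
  (forall x, `|x| <= 4 -> `|g x| <= 4) -> g 0 = 0 ->
  Phi (fun N n => (g (q N n))%:C%C) (G v) =
  Phi (fun N n => (g (truncate (q N n)))%:C%C) (G v).
Proof.
move=> g4 g0.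
have g4' N n : `|g (q N n)| <= 4 by apply: g4; apply: le_trans (q_pi n) pi4.
have bn : bounded (fun N n => (g (truncate (q N n)))%:C%C).
  by apply: (b_truncate (k := 4)) => x x54; apply: g4; lra.
have bf : bounded (fun N n => (g (q N n))%:C%C - (g (truncate (q N n)))%:C%C).
  exists 8%N => N n; apply: le_trans (rnormD _ _) _; rewrite rnormN !rnormC.
  have : `|g (truncate (q N n))| <= 4.
    by apply: g4; have := truncate_le (q N n); lra.
  by have := g4' N n; lra.
rewrite -[RHS]add0r -(@far_negligible
  (fun N n => (g (q N n))%:C%C - (g (truncate (q N n)))%:C%C) v).
- rewrite -(hull_diagD u_basis)//.
  by apply: hull_diag_ext => N n; rewrite subrK.
- move=> N n; rewrite /truncate; case: ifP => _; first by rewrite subrr rnorm0.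
  by rewrite g0 subr0 rnormC.
- by move=> N n h; rewrite /truncate h subrr.
Qed.

Let T := Phi (fun N n => (truncate (q N n))%:C%C).

Let b_T : bounded (fun N n => (truncate (q N n))%:C%C).
Proof. by apply: (b_truncate (g := id) (k := 4)) => x x54; lra. Qed.

Let b_sum J : bounded
  (fun N n => (\sum_(0 <= j < J) sin_coeff' (truncate (q N n)) j)%:C%C).
Proof.
apply: (b_truncate (g := fun x => \sum_(0 <= j < J) sin_coeff' x j)
  (k := 5)) => x x54.
have h1 := sin_tail J x54; have h2 := sin_max x.
have h3 : (1 / 2 : R) ^+ J <= 1 by apply: exprn_ile1; lra.
set s := \sum_(_ <= _ < _) _ in h1 *.
move: h1 h2; rewrite !ler_norml => /andP[? ?] /andP[? ?].
by apply/andP; split; lra.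
Qed.

(** Partial sums of the sine series of T are again diagonal, hence comparable
    with sin q by the uniform estimate [sin_tail]. *)
Let sin_sum_diag J h : sin_sum T J h =
  Phi (fun N n => (\sum_(0 <= j < J) sin_coeff' (truncate (q N n)) j)%:C%C) h.
Proof.
elim: J => [|J IH].
  rewrite /sin_sum big_geq// -[LHS](scale0r (Phi (fun _ _ => 1) h)).
  rewrite -(hull_diagZ u_basis)//.
  by apply: hull_diag_ext => N n; rewrite mul0r big_geq.
rewrite /sin_sum big_nat_recr//= -/(sin_sum T J h) IH -iterS (hull_diagX u_basis)//.
have bX := bounded_symbolX J.*2.+1 b_T.
rewrite -(hull_diagZ u_basis)// -(hull_diagD u_basis)//; last first.
  exact: (bounded_symbolM (bc _) bX).
apply: hull_diag_ext => N n; rewrite big_nat_recr//= [RHS]rmorphD; congr (_ + _).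
by rewrite /sin_coeff' -exprnP -rmorphXn -rmorphM mulrAC.
Qed.

Let sin_intertwine v :
  Phi (fun N n => (sin (q N n))%:C%C) (G v) = G ((2 * 'i%C)^-1 *: (A v - A' v)).
Proof.
have bp := b_expi id; have bm := b_expi -%R.
have bm' := bounded_symbolM (bc (-1)) bm.
have bs := bounded_symbolD bp bm'.
rewrite linearZ linearB/= -AG -exp_adj_intertwine -scaleN1r.
rewrite -(hull_diagZ u_basis _ _ bm) -(hull_diagD u_basis _ bp bm').
rewrite -(hull_diagZ u_basis _ _ bs).
apply: hull_diag_ext => N n.
have i2 : 2 * 'i%C != 0 :> R[i] by rewrite mulf_neq0 ?pnatr_eq0 ?i_neq0.
apply: (mulfI i2); rewrite mulVKf// expiE expiN; ring.
Qed.

(** Both operators now have so small a norm that they are determined by their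
    sines: B by assumption, the other one after truncation of its symbol. *)
Lemma hull_logarithm v : Phi (fun N n => (q N n)%:C%C) (G v) = G (B v).
Proof.
rewrite (truncate_intertwine (g := id))//.
pose Tl : {linear Hm -> Hm} := HB.pack_for {linear Hm -> Hm} T
   (GRing.isLinear.Build R[i] Hm Hm _ T (hull_diag_is_linear u_basis b_T)).
apply: (@sine_rigidity R H Hm G B Tl) => //.
- move=> h; apply: (rnorm_hull_diag u_basis); first by lra.
  by move=> N n; rewrite rnormC truncate_le.
- by exists 1 => // w; rewrite G_iso mul1r.
move=> {}v e e0.
have /rcvgP/(_ (e / 2)) := @sin_sum_cvg _ _ _ B1 v.
move=> /(_ (divr_gt0 e0 (ltr0Sn _ _)))[J1 _ hJ1].
have c2 : `|1 / 2 : R| < 1 by rewrite ger0_norm; lra.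
have /cvgrPdist_lt/(_ (e / 2)) := cvg_geometric (4 * rnorm v) c2.
move=> /(_ (divr_gt0 e0 (ltr0Sn _ _)))[J2 _ hJ2].
exists (J1 + J2)%N; set J := (J1 + J2).+1.
have {hJ1} := hJ1 J (leqW (leq_addr _ _)).
have {hJ2} := hJ2 J (leqW (leq_addl _ _)).
rewrite /= sub0r normrN /geometric/= ger0_norm; last first.
  by rewrite !mulr_ge0 ?rnorm_ge0 ?exprn_ge0//; lra.
move=> h2; rewrite -(G_iso (_ - _)) linearB -sin_intertwine.
rewrite truncate_intertwine ?sin0//; last first.
  by move=> x _; apply: le_trans (sin_max x) _; lra.
set Gs := Phi _ _ => h1.
have h3 : rnorm (sin_sum T J (G v) - Gs) <= 4 * (1 / 2) ^+ J * rnorm v.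
  rewrite sin_sum_diag /Gs -scaleN1r -(hull_diagZ u_basis); last first.
    by apply: (b_truncate (g := sin) (k := 1)) => x _; exact: sin_max.
  rewrite -(hull_diagD u_basis) //; last first.
    apply: (bounded_symbolM (bc _)).
    by apply: (b_truncate (g := sin) (k := 1)) => x _; exact: sin_max.
  rewrite -[X in _ * X]G_iso; apply: (rnorm_hull_diag u_basis).
    by rewrite mulr_ge0// exprn_ge0//; lra.
  move=> N n; rewrite mulN1r -rmorphB rnormC distrC; exact: sin_tail.
rewrite -(subrK Gs (sin_sum T J (G v))) -addrA; apply: le_trans (rnormD _ _) _.
move: h1 h2 h3; rewrite mulrAC; lra.
Qed.

End HullLogarithm.

(** * The vectors P(A, A')phi in the spaces H_N *)
Section LinSpan.
Variables (K : nzRingType) (V : lmodType K).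

Lemma mem_linspan (X : set V) x : X x -> x \in linspan X.
Proof.
move=> Xx; apply/asboolP; exists 1%N, (fun=> 1), (fun=> x); split => //.
by rewrite big_ord1 scale1r.
Qed.

Lemma linspan_sub (X Y : set V) : X `<=` Y -> {subset linspan X <= linspan Y}.
Proof.
move=> XY v /asboolP[n [c [x [Xx vE]]]]; apply/asboolP; exists n, c, x.
by split => // i; apply: XY.
Qed.

End LinSpan.

Lemma subsp_norm (R : realType) (V : innerProductType R[i]) (S : submodClosed V)
  (x : subsp S) : rnorm x = rnorm (val x).
Proof.
apply/eqP; rewrite -(@eqrXn2 _ 2)// ?rnorm_ge0//; apply/eqP/(@complexI R).
by rewrite -!inner_normE.
Qed.

Section Krylov.
Variables (R : realType) (H : hilbertType R[i]).
Implicit Types (P : {poly {poly R[i]}}) (S : H -> H) (x : H).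

Lemma poly2_opMX P (T : {linear H -> H}) S x :
  T (poly2_op P T S x) = poly2_op (P * 'X) T S x.
Proof.
have [->|P0] := eqVneq P 0.
  by rewrite mul0r /poly2_op size_poly0 big_ord0 linear0.
rewrite /poly2_op size_mulX// big_ord_recl coefMX eqxx size_poly0 big_ord0 add0r.
rewrite linear_sum; apply: eq_bigr => i _; rewrite linear_sum coefMX/=.
by apply: eq_bigr => j _; rewrite linearZ.
Qed.

Lemma poly2_op_HNminus P (T : H -> H) x : exists N0, forall N, (N0 <= N)%N ->
  poly2_op P T (adjoint T) x \in HNminus T x N.
Proof.
exists (size P + \sum_(i < size P) size (P`_i)%R)%N => N hN.
rewrite /poly2_op /HNminus; apply: rpred_sum => i _; apply: rpred_sum => j _.
apply: rpredZ; apply: mem_linspan.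
have iN : (i < N)%N by rewrite (leq_trans (ltn_ord i))// (leq_trans (leq_addr _ _) hN).
have jN : (j <= N)%N.
  apply: leq_trans (ltnW (ltn_ord j)) _.
  apply: leq_trans (leq_trans (leq_addl _ _) hN).
  by rewrite (bigD1 i)//= leq_addr.
by exists i => //; exists j.
Qed.

Lemma HNminus_sub_HN (T : H -> H) x N : {subset HNminus T x N <= HN T x N}.
Proof.
apply: linspan_sub => _ [i /= iN] [j jN <-].
by exists i; [exact: ltnW|exists j].
Qed.

End Krylov.

(** The ultrafilter contains no bounded set: a positive square whose root is
    divisible by m is at least m. *)
Lemma near_ge_of_squares (U : set_system nat) (UU : UltraFilter U) :
  (forall m, (1 <= m)%N ->
    U [set N | (1 <= N)%N /\ exists2 k, (k ^ 2)%N = N & (m %| k)%N]) ->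
  forall N0, U [set N | (N0 <= N)%N].
Proof.
move=> Usq N0; apply: filterS (Usq N0.+1 isT) => N /= [N1 [k kN mk]].
have k0 : (0 < k)%N by case: k kN {mk} => // kN; rewrite -kN in N1.
have := dvdn_leq k0 mk => hk.
apply: (leq_trans (ltnW hk)); rewrite -kN -mulnn; exact: leq_pmulr.
Qed.

(** * The operator B^m on the range of G *)
Theorem theorem3p3 (R : realType) (H : hilbertType R[i])
  (H_nonzero : exists v : H, v != 0)
  (H_separable : separable H)
  (B : {linear H -> H})
  (B_bounded : bounded_op B)
  (B_self_adjoint : self_adjoint B)
  (B_norm : opnorm B < 1)
  (B_inj : forall v, v != 0 -> B v != 0)
  (A := op_exp (fun v => 'i%C *: B v))
  (phi : H)
  (phi_norm : `|phi| = 1)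
  (phi_cyclic : cyclic_vector A phi)
  (HN_ := fun N => subsp (HN A phi N) : innerProductType R[i])
  (UN : forall N, {linear subsp (Wminus A phi N) -> subsp (Wplus A phi N)})
  (UN_unitary : forall N, unitary_map (UN N))
  (AN : forall N, {linear HN_ N -> HN_ N})
  (AN_minus : forall N (v : HN_ N), val v \in HNminus A phi N ->
    val (AN N v) = A (val v))
  (AN_W : forall N (v : HN_ N) (w : subsp (Wminus A phi N)), val v = val w ->
    val (AN N v) = val (UN N w))
  (D : nat -> nat)
  (u : forall N, 'I_(D N) -> HN_ N)
  (u_basis : forall N, orthonormal_basis (u N))
  (lambda : forall N, 'I_(D N) -> R[i])
  (u_eigen : forall N n, AN N (u N n) = lambda N n *: u N n)
  (xi : forall N, 'I_(D N) -> R)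
  (xiE : forall N n, inner (val (u N n)) phi = (xi N n)%:C%C)
  (xi_ge0 : forall N n, 0 <= xi N n)
  (BN : forall N, {linear HN_ N -> HN_ N})
  (BN_eigen : forall N n, exists q : R, [/\ - pi < q, q <= pi,
    lambda N n = expi q & BN N (u N n) = q%:C%C *: u N n])
  (U : set_system nat)
  (U_ultra : UltraFilter U)
  (U_sqrt : forall m, (1 <= m)%N ->
    U [set N | (1 <= N)%N /\ exists2 k, (k ^ 2)%N = N & (m %| k)%N])
  (Hm := hull U_ultra HN_ : innerProductType R[i])
  (G : {linear H -> Hm})
  (G_isometric : forall v, `|G v| = `|v|)
  (G_poly : forall (P : {poly {poly R[i]}}) (x : forall N, HN_ N),
    (\forall N \near U, val (x N) = poly2_op P A (adjoint A) phi) ->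
    G (poly2_op P A (adjoint A) phi) = hull_class (uclass U_ultra x))
  (M : nat)
  (M_gt1 : (1 < M)%N)
  (mu_n := fun X : set R[i] =>
    lim (spectral_measure (lambda N) (xi N) X @[N --> U]) : R)
  (NI : set R)
  (NI_countable : countable NI)
  (NI_nice : forall r, NI r -> nice mu_n M r)
  (NI_dense : `[- M%:R, M%:R]%classic `<=` closure NI)
  (NI_bounds : NI (- M%:R) /\ NI M%:R)
  (NI_cos1 : NI (complex.Re (expi 1))) :
  {in range G, hull_map BN =1 G \o B \o 'pinv_(fun=> 0) [set: H] G}.
Proof.
have B1 := opnorm_contraction B_bounded B_norm.
have i1 : rnorm ('i%C : R[i]) <= 1 by rewrite rnormi.
pose Al : {linear H -> H} := op_expl B1 i1.
have G_iso v : rnorm (G v) = rnorm v by rewrite /rnorm G_isometric.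
have [q qP] : exists q : forall N, 'I_(D N) -> R, forall N n,
    [/\ - pi < q N n, q N n <= pi, lambda N n = expi (q N n) &
        BN N (u N n) = (q N n)%:C%C *: u N n].
  exists (fun N n => projT1 (cid (BN_eigen N n))) => N n.
  exact: projT2 (cid (BN_eigen N n)).
have q_pi N n : `|q N n| <= pi.
  by have [q1 q2 _ _] := qP N n; rewrite ler_norml (ltW q1) q2.
have BNE N : BN N =1 diag (u N) (fun n => (q N n)%:C%C).
  apply: (basis_ext (u_basis N) (g := diag (u N) (fun n => (q N n)%:C%C))) => n.
  by rewrite /= (diag_vect (u_basis N)); have [_ _ _ ->] := qP N n.
have ANE N : AN N =1 diag (u N) (fun n => expi (q N n)).
  apply: (basis_ext (u_basis N) (g := diag (u N) (fun n => expi (q N n)))) => n.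
  by rewrite /= (diag_vect (u_basis N)) u_eigen; have [_ _ -> _] := qP N n.
(* both sides are Lipschitz in v, so vectors P(A, A')phi suffice *)
have AG v :
    @hull_diag R U U_ultra HN_ D u (fun N n => expi (q N n)) (G v) = G (A v).
  have bl : @bounded_symbol R D (fun N n => expi (q N n)).
    by exists 1%N => N n; rewrite rnorm_expi.
  have e1 : 1 <= expR 1 :> R by have := expR_ge1Dx (1 : R); lra.
  apply: (dense_lipschitz_eq (k := expR 1) phi_cyclic
    (f := fun v => @hull_diag R U U_ultra HN_ D u (fun N n => expi (q N n)) (G v))
    (g := fun v => G (A v))).
  - move=> x y.
    apply: le_trans (hull_diag_lipschitz u_basis (G x) (G y) ler01 _) _.
      by move=> N n; rewrite rnorm_expi.
    by rewrite mul1r -linearB G_iso ler_peMl ?rnorm_ge0.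
  - move=> x y; rewrite -linearB G_iso.
    apply: (linear_lipschitz (f := Al) (k := expR 1)) => w; exact: op_exp_le.
  move=> _ [P _ <-].
  set psi := poly2_op P A (adjoint A) phi.
  have [N0 psiN] := poly2_op_HNminus P A phi.
  (* the default 0 is reached for finitely many N only *)
  pose x N : HN_ N := insubd (0 : subsp (HN A phi N)) psi.
  have xE N : (N0 <= N)%N -> val (x N) = psi.
    by move=> NN; rewrite /x insubdK// (HNminus_sub_HN (psiN N NN)).
  have Uinf := near_ge_of_squares U_ultra U_sqrt.
  have fx : uclass U_ultra x \in @ufinite R U U_ultra HN_.
    apply/ufiniteP; exists (Num.bound (rnorm psi)).
    apply: filterS (Uinf N0) => N /= NN.
    rewrite rnormE subsp_norm xE// -(rmorph_nat (real_complex R)) lecR.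
    exact/ltW/archi_boundP/rnorm_ge0.
  rewrite (G_poly P x); last by apply: filterS (Uinf N0) => N /= /xE.
  rewrite (hull_diagE u_basis)//.
  rewrite [psi](_ : _ = poly2_op P A (adjoint A) phi)//.
  have -> : A (poly2_op P A (adjoint A) phi) = poly2_op (P * 'X) A (adjoint A) phi.
    exact: (poly2_opMX P Al).
  apply/esym/G_poly; apply: filterS (Uinf N0) => N /= NN.
  rewrite -ANE AN_minus ?xE// ?psiN//.
  exact: (poly2_opMX P Al).
move=> _ /set_mem[v _ <-].
have Ginj : {in [set: H] &, injective G}.
  move=> x y _ _ /eqP; rewrite -subr_eq0 -linearB => /eqP Gxy.
  apply/eqP; rewrite -subr_eq0; apply/eqP/rnorm_eq0.
  by rewrite -G_iso Gxy rnorm0.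
rewrite /= pinvKV ?inE//.
rewrite -(hull_logarithm u_basis q_pi B1 B_self_adjoint G_iso AG).
congr (hull_map _ _); apply: functional_extensionality_dep => N.
exact/funext/BNE.
Qed.
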